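(* Let $\{X_j\}$ be a fourth-order stationary sequence with $\mu=EX_j$, autocovariances $\gamma_j=\mathrm{Cov}(X_0,X_j)$ and fourth-order cumulants $\kappa(h,r,s)$, such that for some $\frac12<H<1$: (a) $n^{-H}\sum_{1\le j\le nt}(X_j-\mu)\xrightarrow{d}c_HW_H(t)$ in $D[0,1]$ for some $c_H>0$; (b) $\gamma_j\sim c_0j^{2H-2}$ for some $c_0>0$; (c) $\sup_h\sum_{-n\le r,s\le n}|\kappa(h,r,s)|=O(n^{2H-1})$. If $q(n)\to\infty$ and $q(n)/n\to0$, then $$\Big(\frac{q(n)}n\Big)^{H-1/2}T_n\xrightarrow{d}\sup_{0\le t\le1}|W_H(t)-tW_H(1)|.$$
   Context: $W_H$ is fractional Brownian motion: a mean-zero Gaussian process with $E[W_H(t)W_H(s)]=(t^{2H}+s^{2H}-|t-s|^{2H})/2$. Fourth-order stationary means finite fourth moments and shift-invariant joint moments of order at most four; $\kappa(h,r,s)=E[Z_kZ_{k+h}Z_{k+r}Z_{k+s}]-(\gamma_h\gamma_{r-s}+\gamma_r\gamma_{h-s}+\gamma_s\gamma_{h-r})$ with $Z_k=X_k-\mu$. $a_j\sim b_j$ means $a_j/b_j\to1$. $q(n)$ is a sequence of positive integers, $\omega_j(q)=1-j/(q+1)$, $\bar X_n=\frac1n\sum_{i\le n}X_i$, $\hat\gamma_j=\frac1n\sum_{1\le i\le n-j}(X_i-\bar X_n)(X_{i+j}-\bar X_n)$, $s_n^2=\hat\gamma_0+2\sum_{1\le j\le q(n)}\omega_j(q(n))\hat\gamma_j$,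 $T_n=\frac1{n^{1/2}s_n}\max_{1\le k\le n}|\sum_{i\le k}X_i-\frac kn\sum_{i\le n}X_i|$. *)

(* Defs.v *)
From HB Require Import structures.
From mathcomp Require Import all_boot all_order all_algebra.
From mathcomp Require Import all_classical all_reals all_analysis.
Set Implicit Arguments. Unset Strict Implicit. Unset Printing Implicit Defensive.
Import Order.TTheory GRing.Theory Num.Theory.
Import numFieldNormedType.Exports.
Local Open Scope classical_set_scope.
Local Open Scope ring_scope.

Section defs.
Context {R : realType}.

Section sample.
Context {d : measure_display} {T : measurableType d} (P : probability T R).

Definition fourth_order_stationary (X : nat -> T -> R) : Prop :=
  (forall j, P.-integrable setT (fun w => (`|X j w| ^+ 4)%:E)) /\
  (forall (s : seq nat) (k : nat), (size s <= 4)%N ->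
     ('E_P[fun w => (\prod_(i <- s) X (i + k)%N w)%R] =
      'E_P[fun w => (\prod_(i <- s) X i w)%R])%E).

Definition mean (X : nat -> T -> R) : R := fine ('E_P[X 0%N])%E.

(* gamma_h = Cov(X_0, X_|h|)  (= Cov(X_k, X_{k+h}) by stationarity) *)
Definition gamma (X : nat -> T -> R) (h : int) : R :=
  fine ('E_P[fun w => ((X 0%N w - mean X) * (X (absz h) w - mean X))%R])%E.

(* kappa(h,r,s) = E[Z_k Z_{k+h} Z_{k+r} Z_{k+s}] - (...), with Z = X - mu;
   the base index k := |h|+|r|+|s| makes all indices nonnegative
   (by stationarity the value does not depend on such k). *)
Definition kappa (X : nat -> T -> R) (h r s : int) : R :=
  let k : int := (`|h| + `|r| + `|s|)%N%:Z in
  let Z (i : int) (w : T) := X (absz (k + i)) w - mean X in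
  fine ('E_P[fun w => (Z 0 w * Z h w * Z r w * Z s w)%R])%E
  - (gamma X h * gamma X (r - s) + gamma X r * gamma X (h - s)
     + gamma X s * gamma X (h - r)).

Definition partial_sum_process (X : nat -> T -> R) (H : R) (n : nat)
    (t : R) (w : T) : R :=
  n%:R `^ (- H) *
  \sum_(1 <= j < (Num.truncn (n%:R * t)).+1) (X j w - mean X).

Definition xbar (X : nat -> T -> R) (n : nat) (w : T) : R :=
  n%:R^-1 * \sum_(1 <= i < n.+1) X i w.

Definition gamma_hat (X : nat -> T -> R) (n j : nat) (w : T) : R :=
  n%:R^-1 * \sum_(1 <= i < (n - j).+1)
              (X i w - xbar X n w) * (X (i + j)%N w - xbar X n w).

Definition bartlett (q j : nat) : R := 1 - j%:R / (q.+1)%:R.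

Definition s2 (X : nat -> T -> R) (q : nat -> nat) (n : nat) (w : T) : R :=
  gamma_hat X n 0 w
  + 2 * \sum_(1 <= j < (q n).+1) bartlett (q n) j * gamma_hat X n j w.

Definition Tn (X : nat -> T -> R) (q : nat -> nat) (n : nat) (w : T) : R :=
  (Num.sqrt n%:R * Num.sqrt (s2 X q n w))^-1 *
  \big[Num.max/0]_(1 <= k < n.+1)
     `| \sum_(1 <= i < k.+1) X i w - k%:R / n%:R * \sum_(1 <= i < n.+1) X i w |.

End sample.

Definition fbm_cov (H t s : R) : R :=
  (t `^ (2 * H) + s `^ (2 * H) - `|t - s| `^ (2 * H)) / 2.

(* W is a mean-zero Gaussian process on [0,1] with covariance fbm_cov H:
   every finite linear combination sum a_i W(t_i) is N(0, sum a_i a_j cov)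
   (a point mass at 0 if that variance is 0); paths continuous on [0,1]. *)
Definition is_fBm {d : measure_display} {T : measurableType d}
    (Q : probability T R) (H : R) (W : R -> T -> R) : Prop :=
  (forall t, measurable_fun setT (W t)) /\
  (forall w, {within `[0, 1], continuous (fun t => W t w)}) /\
  (forall (s : seq (R * R)), all (fun p => (0 <= p.2 <= 1)) s ->
     let v := \sum_(p <- s) \sum_(p' <- s) p.1 * p'.1 * fbm_cov H p.2 p'.2 in
     forall A : set R, measurable A ->
       Q [set w | \sum_(p <- s) p.1 * W p.2 w \in A] =
       (if v == 0 then \d_(0 : R) A else normal_prob 0 (Num.sqrt v) A)).

Definition cadlag01 (x : R -> R) : Prop :=
  (forall t : R, 0 <= t < 1 -> x @ t^'+ --> x t) /\
  (forall t, 0 < t <= 1 -> exists l : R, x @ t^'- --> l).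

Definition time_change (lam : R -> R) : Prop :=
  lam 0 = 0 /\ lam 1 = 1 /\ {within `[0, 1], continuous lam} /\
  (forall s t, 0 <= s -> s < t -> t <= 1 -> lam s < lam t).

Definition skorokhod_close (x y : R -> R) (e : R) : Prop :=
  exists lam, time_change lam /\
    forall t, 0 <= t <= 1 -> `|lam t - t| <= e /\ `|x t - y (lam t)| <= e.

Definition D_test (F : (R -> R) -> R) : Prop :=
  (exists M, forall x, cadlag01 x -> `|F x| <= M) /\
  (forall x, cadlag01 x -> forall e, 0 < e -> exists2 delta, 0 < delta &
     forall y, cadlag01 y -> skorokhod_close x y delta -> `|F x - F y| < e).

Definition D_converges {d d' : measure_display} {T : measurableType d}
    {T' : measurableType d'} (P : probability T R) (Q : probability T' R)
    (Sn : nat -> R -> T -> R) (S : R -> T' -> R) : Prop :=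
  forall F, D_test F ->
    ('E_P[fun w => F (fun t => Sn n t w)] @[n --> \oo] -->
     'E_Q[fun w => F (fun t => S t w)])%E.

Definition conv_dist {d d' : measure_display} {T : measurableType d}
    {T' : measurableType d'} (P : probability T R) (Q : probability T' R)
    (Yn : nat -> T -> R) (Y : T' -> R) : Prop :=
  forall g : R -> R, continuous g -> (exists M, forall x, `|g x| <= M) ->
    ('E_P[fun w => g (Yn n w)] @[n --> \oo] --> 'E_Q[fun w => g (Y w)])%E.

End defs.

(* Main.v *)
Require Import Defs.
From HB Require Import structures.
From mathcomp Require Import all_boot all_order all_algebra.
From mathcomp Require Import all_classical all_reals all_analysis.
From mathcomp Require Import measurable_realfun zify ring lra.
Import Order.TTheory GRing.Theory Num.Theory.
Import numFieldNormedType.Exports.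
Local Open Scope classical_set_scope.
Local Open Scope ring_scope.
Set Implicit Arguments. Unset Strict Implicit.

(* Put a = 2H - 1, m = q(n) + 1 and Z = X - mu. Up to recentring by the sample
   mean, n m s_n^2 is the quadratic form with weights (m - |i - j|)_+ in the Z_i.
   Its expectation is n Var(Z_1 + ... + Z_m) + O(m^2 m^a), and by (b) and (c) its
   variance and the effect of recentring are controlled by powers of
   (m/n)^(1-a), so s_n^2 / q^a - Var(Z_1 + ... + Z_m) / m^(1+a) tends to 0 in L^1.
   Fourth moments of the partial sums are bounded in the same way, so (a) at
   t = 1 passes to second moments and Var(Z_1 + ... + Z_m) / m^(1+a) -> c_H^2;
   in particular the constant c_0 of (b) never has to be identified. Finally
   x |-> sup |x(t) - t x(1)| is continuous for the Skorokhod topology, and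
   (q/n)^(H-1/2) T_n is its value at the partial sum process, up to a negligible
   error, divided by (s_n^2 / q^a)^(1/2). *)

(** * Real-valued expectations and variables with finite fourth moment *)

Section Expectation.
Context {R : realType} {d : measure_display} {T : measurableType d}.
Variable P : probability T R.
Implicit Types f g h k : T -> R.

(** The statistic combines a functional of the path with $s_n^2$, and (a) says nothing about their
    joint law. None is required: $s_n^2/q^a$ has a deterministic limit, so an $L^1$ estimate and a
    Markov-type bound suffice for the final comparison.

    Two obstacles shape the estimates. Condition (b) is asymptotic and gives no monotonicity of
    $\gamma_h$, so all bounds go through a decreasing majorant $g(h)=D(h+1)^{a-1}$ with
    $\sum_{h<n}g(h)\le Kn^a$. With weights at most $m$ on a window of width $m$, the variance of the
    form is then $O(m^2\cdot nm\cdot n^am^a)$; divided by $(nm\cdot m^a)^2$ this is $(m/n)^{1-a}$,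
    which vanishes since $a<1$ and $q/n\to0$.

    Weak convergence alone does not pass to second moments. There $u^2$ is replaced by the bounded
    function $\frac2b(1-e^{-bu^2/2})$: bounded fourth moments make the replacement cost $O(b)$
    uniformly in $n$, and its limit is a Gaussian Laplace transform in closed form, so no moment of
    $W_H(1)$ has to be integrated. *)

Definition intg (f : T -> R) : Prop := P.-integrable setT (EFin \o f).
(** [Rintegral] returns 0 on an infinite integral, so integrability is carried separately by
    [intg]. *)
Definition Ex (f : T -> R) : R := Rintegral P setT f.

Lemma ExE f : intg f -> 'E_P[f]%E = (Ex f)%:E.
Proof. by move=> fi; rewrite unlock /Ex /Rintegral fineK// integrable_fin_num. Qed.

Lemma fine_Ex f : fine 'E_P[f]%E = Ex f.
Proof. by rewrite unlock. Qed.

Lemma intgD f g : intg f -> intg g -> intg (fun w => f w + g w).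
Proof. by move=> fi gi; exact: (integrableD measurableT fi gi). Qed.

Lemma intgZ (c : R) f : intg f -> intg (fun w => c * f w).
Proof. by move=> fi; exact: (integrableZl measurableT c fi). Qed.

Lemma intgB f g : intg f -> intg g -> intg (fun w => f w - g w).
Proof. by move=> fi gi; exact: (integrableB measurableT fi gi). Qed.

Lemma intg_cst (c : R) : intg (fun _ => c).
Proof. exact: finite_measure_integrable_cst. Qed.

Lemma intg_norm f : intg f -> intg (fun w => `|f w|).
Proof. exact: integrable_norm. Qed.

Lemma intg_le f g : measurable_fun setT f -> (forall w, `|f w| <= g w) ->
  intg g -> intg f.
Proof.
move=> mf fg gi; apply: (le_integrable measurableT _ _ gi).
  exact/measurable_EFinP.
by move=> w _ /=; rewrite lee_fin [leRHS]ger0_norm// (le_trans (normr_ge0 _) (fg w)).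
Qed.

Lemma intg_bounded f M : measurable_fun setT f -> (forall w, `|f w| <= M) -> intg f.
Proof. by move=> mf fM; apply: (@intg_le f (fun _ => M)) => //; exact: intg_cst. Qed.

Lemma intg_sum I (r : seq I) (p : pred I) (f : I -> T -> R) :
  (forall i, p i -> intg (f i)) -> intg (fun w => \sum_(i <- r | p i) f i w).
Proof.
move=> fi; elim: r => [|i r ih].
  rewrite [X in intg X](_ : _ = fun=> 0); first exact: intg_cst.
  by apply/funext => w; rewrite big_nil.
have [pi|pi] := boolP (p i).
  rewrite [X in intg X](_ : _ = fun w => f i w + \sum_(j <- r | p j) f j w).
    by apply: intgD => //; exact: fi.
  by apply/funext => w; rewrite big_cons pi.
rewrite [X in intg X](_ : _ = fun w => \sum_(j <- r | p j) f j w)//.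
by apply/funext => w; rewrite big_cons (negbTE pi).
Qed.

Lemma eq_Ex f g : f =1 g -> Ex f = Ex g.
Proof. by move=> /funext ->. Qed.

Lemma ExD f g : intg f -> intg g -> Ex (fun w => f w + g w) = Ex f + Ex g.
Proof. by move=> fi gi; exact: RintegralD. Qed.

Lemma ExB f g : intg f -> intg g -> Ex (fun w => f w - g w) = Ex f - Ex g.
Proof. by move=> fi gi; exact: RintegralB. Qed.

Lemma ExZ (c : R) f : intg f -> Ex (fun w => c * f w) = c * Ex f.
Proof. by move=> fi; exact: RintegralZl. Qed.

Lemma Ex_cst (c : R) : Ex (fun _ => c) = c.
Proof.
rewrite /Ex Rintegral_cst// [X in fine X](_ : _ = 1%E) ?mulr1//.
exact: probability_setT.
Qed.

Lemma Ex_sum I (r : seq I) (p : pred I) (f : I -> T -> R) :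
  (forall i, p i -> intg (f i)) ->
  Ex (fun w => \sum_(i <- r | p i) f i w) = \sum_(i <- r | p i) Ex (f i).
Proof.
move=> fi; elim: r => [|i r ih].
  rewrite (@eq_Ex _ (fun=> 0)) ?Ex_cst ?big_nil// => w.
  by rewrite big_nil.
rewrite big_cons; have [pi|pi] := boolP (p i).
  rewrite (@eq_Ex _ (fun w => f i w + \sum_(j <- r | p j) f j w)).
    by rewrite ExD ?ih//; [exact: fi|exact: intg_sum].
  by move=> w; rewrite big_cons pi.
by rewrite -ih; apply: eq_Ex => w; rewrite big_cons (negbTE pi).
Qed.

Lemma Ex_ge0 f : (forall w, 0 <= f w) -> 0 <= Ex f.
Proof. by move=> f0; exact: Rintegral_ge0. Qed.

Lemma le_Ex f g : intg f -> intg g -> (forall w, f w <= g w) -> Ex f <= Ex g.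
Proof. by move=> fi gi fg; apply: le_Rintegral. Qed.

Lemma le_norm_Ex f : intg f -> `|Ex f| <= Ex (fun w => `|f w|).
Proof. by move=> fi; exact: le_normr_Rintegral. Qed.

(** Expanding $E(|f|-e)^2\ge0$ with $e=E|f|$ gives $e^2\le E f^2$. *)
Lemma Ex_norm_le_sqrt f : intg f -> intg (fun w => f w ^+ 2) ->
  Ex (fun w => `|f w|) <= Num.sqrt (Ex (fun w => f w ^+ 2)).
Proof.
move=> fi f2i; set e := Ex _.
have e0 : 0 <= e by apply: Ex_ge0.
have : 0 <= Ex (fun w => (`|f w| - e) ^+ 2) by apply: Ex_ge0 => w; exact: sqr_ge0.
rewrite (eq_Ex (g := fun w => f w ^+ 2 - (2 * e * `|f w| - e ^+ 2))); last first.
  by move=> w; rewrite sqrrB real_normK ?num_real//; ring.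
have ai := intg_norm fi.
have ai' := intgZ (2 * e) ai; have ei := intg_cst (e ^+ 2).
rewrite ExB//; last exact: intgB.
rewrite ExB// ExZ// Ex_cst.
rewrite -/e => h.
rewrite -(ler_sqr e0) ?nnegrE ?sqrtr_ge0// sqr_sqrtr; first lra.
by apply: Ex_ge0 => w; exact: sqr_ge0.
Qed.

Definition L4 (f : T -> R) : Prop :=
  measurable_fun setT f /\ intg (fun w => f w ^+ 4).

Lemma L4_cst (c : R) : L4 (fun _ => c).
Proof. by split; [exact: measurable_cst|exact: intg_cst]. Qed.

Lemma L4Z (c : R) f : L4 f -> L4 (fun w => c * f w).
Proof.
move=> [mf fi]; split; first exact: measurable_funM.
by under eq_fun do rewrite exprMn; exact: intgZ.
Qed.

Lemma L4D f g : L4 f -> L4 g -> L4 (fun w => f w + g w).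
Proof.
move=> [mf fi] [mg gi]; split; first exact: measurable_funD.
(* The 8 comes from using $(a+b)^2\le2(a^2+b^2)$ twice. *)
apply: (@intg_le _ (fun w => 8 * (f w ^+ 4 + g w ^+ 4))).
- by apply: measurable_funX; exact: measurable_funD.
- move=> w; rewrite ger0_norm ?exprn_even_ge0//; set a := f w; set b := g w.
  have h1 : (a + b) ^+ 2 <= 2 * (a ^+ 2 + b ^+ 2).
    by have := sqr_ge0 (a - b); nra.
  have h2 : (2 * (a ^+ 2 + b ^+ 2)) ^+ 2 <= 8 * (a ^+ 4 + b ^+ 4).
    by have := sqr_ge0 (a ^+ 2 - b ^+ 2); nra.
  apply: le_trans h2; rewrite (_ : (a + b) ^+ 4 = ((a + b) ^+ 2) ^+ 2); last by rewrite -exprM.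
  apply: (lerXn2r _ _ _ h1); rewrite nnegrE; first exact: sqr_ge0.
  exact: le_trans (sqr_ge0 (a + b)) h1.
- by apply: intgZ; exact: intgD.
Qed.

Lemma L4B f g : L4 f -> L4 g -> L4 (fun w => f w - g w).
Proof.
move=> fi gi; have := L4D fi (L4Z (-1) gi).
by under eq_fun do rewrite mulN1r.
Qed.

Lemma L4_norm f : L4 f -> L4 (fun w => `|f w|).
Proof.
move=> [mf fi]; split; first exact: measurableT_comp.
by under eq_fun do rewrite -normrX ger0_norm ?exprn_even_ge0//.
Qed.

Lemma L4_sum I (r : seq I) (p : pred I) (f : I -> T -> R) :
  (forall i, p i -> L4 (f i)) -> L4 (fun w => \sum_(i <- r | p i) f i w).
Proof.
move=> fi; elim: r => [|i r ih].
  rewrite [X in L4 X](_ : _ = fun=> 0); first exact: L4_cst.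
  by apply/funext => w; rewrite big_nil.
have [pi|pi] := boolP (p i).
  rewrite [X in L4 X](_ : _ = fun w => f i w + \sum_(j <- r | p j) f j w).
    by apply: L4D => //; exact: fi.
  by apply/funext => w; rewrite big_cons pi.
rewrite [X in L4 X](_ : _ = fun w => \sum_(j <- r | p j) f j w)//.
by apply/funext => w; rewrite big_cons (negbTE pi).
Qed.

(** Each factor is at most $u=1+\sum|f_i|$, which is again in [L4]. The summand 1 gives $u\ge1$, so
    that $u^4$ also dominates products of fewer than four factors. *)
Lemma intg_prod4 I (s : seq I) (f : I -> T -> R) : (size s <= 4)%N ->
  (forall i, L4 (f i)) -> intg (fun w => \prod_(i <- s) f i w).
Proof.
move=> s4 fi.
pose u w := 1 + \sum_(i <- s) `|f i w|.
have [mu iu] : L4 u.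
  by apply: L4D; [exact: L4_cst|apply: L4_sum => i _; exact: L4_norm].
apply: intg_le iu.
  elim: (s) => [|i t ih].
    rewrite [X in measurable_fun _ X](_ : _ = fun=> 1); first exact: measurable_cst.
    by apply/funext => w; rewrite big_nil.
  rewrite [X in measurable_fun _ X](_ : _ = fun w => f i w * \prod_(j <- t) f j w).
    by apply: measurable_funM => //; case: (fi i).
  by apply/funext => w; rewrite big_cons.
move=> w; rewrite normr_prod.
have u1 : 1 <= u w by rewrite lerDl sumr_ge0.
apply: (@le_trans _ _ (u w ^+ size s)); last exact: ler_weXn2l.
suff : forall t v, \sum_(i <- t) `|f i w| <= v -> 0 <= v ->
    \prod_(i <- t) `|f i w| <= v ^+ size t.
  apply; last exact: (le_trans ler01).
  by rewrite /u lerDr.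
elim=> [|i t ih] v; first by rewrite !big_nil expr0.
rewrite !big_cons /= exprS => le_v v0.
have t0 : 0 <= \sum_(j <- t) `|f j w| by rewrite sumr_ge0.
apply: ler_pM => //.
- by rewrite prodr_ge0.
- by rewrite (le_trans _ le_v)// lerDl.
- by apply: ih => //; rewrite (le_trans _ le_v)// lerDr.
Qed.

Lemma L4_intg f : L4 f -> intg f.
Proof.
move=> fi; have := @intg_prod4 unit [:: tt] (fun _ => f) isT (fun _ => fi).
rewrite [X in intg X](_ : _ = f)//.
by apply/funext => w; rewrite big_seq1.
Qed.

Lemma L4_intg2 f g : L4 f -> L4 g -> intg (fun w => f w * g w).
Proof.
move=> fi gi; have := @intg_prod4 bool [:: true; false] (fun b => if b then f else g) isT.
rewrite [X in intg X](_ : _ = fun w => f w * g w); last first.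
  by apply/funext => w; rewrite !big_cons big_nil mulr1.
by apply; case.
Qed.

Lemma L4_intg4 f g h k : L4 f -> L4 g -> L4 h -> L4 k ->
  intg (fun w => f w * g w * h w * k w).
Proof.
move=> fi gi hi ki.
have := @intg_prod4 nat [:: 0%N; 1%N; 2%N; 3%N] (fun i => nth k [:: f; g; h] i) isT.
rewrite [X in intg X](_ : _ = fun w => f w * g w * h w * k w); last first.
  by apply/funext => w; rewrite !big_cons big_nil mulr1 !mulrA.
by apply; do 3 case => //; case.
Qed.

End Expectation.

(** * Sums over index pairs at bounded distance *)

Section WindowSums.
Context {R : realType}.
Implicit Types (f g : nat -> R) (n m k : nat).

Lemma sum_indic_eq n (c : nat) : \sum_(l < n) ((l : nat) == c)%:R <= 1 :> R.
Proof.
have [cn|cn] := ltnP c n.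
  rewrite (bigD1 (Ordinal cn))//= eqxx big1 ?addr0// => l lc.
  by case: eqP => // lc'; case/eqP: lc; apply/val_inj.
rewrite big1// => l _; case: eqP => // lc.
by have := ltn_ord l; lia.
Qed.

(** A given distance $h$ to $k$ is attained by at most the two indices $k+h$ and $k-h$. *)
Lemma window_sum f n m k : (forall h, 0 <= f h) ->
  \sum_(l < n) (`|k - l| < m)%N%:R * f `|k - l|%N <= 2 * \sum_(h < m) f h.
Proof.
move=> f0.
apply: (@le_trans _ _ (\sum_(l < n) \sum_(h < m)
    (((l : nat) == (k + h)%N)%:R + ((l + h)%N == k)%:R) * f h)).
  apply: ler_sum => l _; case: (ltnP `|k - l| m) => [lm|_].
    rewrite (bigD1 (Ordinal lm))//= -[leLHS]addr0 lerD//; last first.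
      by apply: sumr_ge0 => h _; rewrite mulr_ge0// addr_ge0.
    rewrite ler_wpM2r//.
    have [kl|kl] := leqP k l.
      rewrite (_ : (l : nat) == _) ?lerDl//; lia.
    rewrite (_ : (l + _)%N == k) ?lerDr//; lia.
  by rewrite mul0r; apply: sumr_ge0 => h _; rewrite mulr_ge0// addr_ge0.
rewrite exchange_big mulr_sumr /=; apply: ler_sum => h _.
rewrite -mulr_suml ler_wpM2r// big_split /= (_ : 2 = 1 + 1)//.
apply: lerD; first exact: sum_indic_eq.
have [hk|hk] := leqP h k.
  apply: le_trans (sum_indic_eq n (k - h)).
  apply: ler_sum => l _; rewrite ler_nat.
  by case: eqP => //; case: eqP => //; lia.
rewrite big1// => l _; case: eqP => //; lia.
Qed.

Lemma window_count n m k : \sum_(l < n) (`|k - l| < m)%N%:R <= 2 * m%:R :> R.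
Proof.
have := @window_sum (fun=> 1) n m k (fun=> ler01).
by rewrite sumr_const card_ord; under eq_bigr do rewrite mulr1.
Qed.

Lemma sum_dist f n (i : 'I_n) : (forall h, 0 <= f h) ->
  \sum_(j < n) f `|i - j|%N <= 2 * \sum_(h < n) f h.
Proof.
move=> f0; apply: le_trans (window_sum n n i f0).
apply: ler_sum => j _; rewrite (_ : (_ < _)%N) ?mul1r//.
have := ltn_ord i; have := ltn_ord j; lia.
Qed.

(* Either |j-l| < m, or |k-l| < m <= |j-l| and monotonicity applies. *)
Lemma window_sum_shift g n m k (j : nat) : (forall h, 0 <= g h) ->
  (forall h h', (h <= h')%N -> g h' <= g h) ->
  \sum_(l < n) (`|k - l| < m)%N%:R * g `|j - l|%N <= 4 * \sum_(h < m) g h.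
Proof.
move=> g0 gdec.
apply: (@le_trans _ _ (\sum_(l < n) ((`|k - l| < m)%N%:R * g `|k - l|%N
                                 + (`|j - l| < m)%N%:R * g `|j - l|%N))).
  apply: ler_sum => l _.
  case: (ltnP `|k - l| m) => [klm|_]; last first.
    by rewrite !mul0r add0r mulr_ge0.
  rewrite !mul1r; case: (ltnP `|j - l| m) => [_|jlm].
    by rewrite mul1r lerDr.
  by rewrite mul0r addr0 gdec//; lia.
rewrite big_split /=.
apply: le_trans (lerD (window_sum n m k g0) (window_sum n m j g0)) _.
lra.
Qed.

(** For fixed $i,k$ the sum over $l$ costs $4\sum_{h<m}g$ and the sum over $j$ costs $2m$; then $k$
    costs $2\sum_{h<n}g$ and $i$ costs $n$. Monotonicity of $g$ enters in the sum over $l$, whose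
    window is centred at $k$ and not at $j$. *)
Lemma window_quad_sum g n m : (forall h, 0 <= g h) ->
  (forall h h', (h <= h')%N -> g h' <= g h) ->
  \sum_(i < n) \sum_(j < n) \sum_(k < n) \sum_(l < n)
     (`|i - j| < m)%N%:R * (`|k - l| < m)%N%:R * (g `|i - k|%N * g `|j - l|%N)
  <= 16 * (n%:R * m%:R * (\sum_(h < n) g h) * (\sum_(h < m) g h)).
Proof.
move=> g0 gdec; set Gn := \sum_(h < n) g h; set Gm := \sum_(h < m) g h.
have Gm0 : 0 <= Gm by apply: sumr_ge0.
apply: (@le_trans _ _ (\sum_(i < n) \sum_(k < n) \sum_(j < n) \sum_(l < n)
   g `|i - k|%N * ((`|i - j| < m)%N%:R * ((`|k - l| < m)%N%:R * g `|j - l|%N)))).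
  apply: ler_sum => i _; rewrite exchange_big; apply: ler_sum => j _.
  by apply: ler_sum => k _; apply: ler_sum => l _; rewrite le_eqVlt; apply/orP; left; apply/eqP; ring.
apply: (@le_trans _ _ (\sum_(i < n) 16 * (m%:R * Gn * Gm))); last first.
  by rewrite sumr_const card_ord -mulr_natl le_eqVlt; apply/orP; left; apply/eqP; ring.
apply: ler_sum => i _.
apply: (@le_trans _ _ (\sum_(k < n) g `|i - k|%N * (8 * (m%:R * Gm)))); last first.
  rewrite -mulr_suml.
  apply: (@le_trans _ _ (2 * Gn * (8 * (m%:R * Gm)))).
    by rewrite ler_wpM2r ?sum_dist// !mulr_ge0.
  by rewrite le_eqVlt; apply/orP; left; apply/eqP; ring.
apply: ler_sum => k _; under eq_bigr do rewrite -mulr_sumr.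
rewrite -mulr_sumr ler_wpM2l//.
apply: (@le_trans _ _ (\sum_(j < n) (`|i - j| < m)%N%:R * (4 * Gm))).
  apply: ler_sum => j _; rewrite -mulr_sumr ler_wpM2l//.
  exact: window_sum_shift.
rewrite -mulr_suml.
apply: (@le_trans _ _ (2 * m%:R * (4 * Gm))).
  by rewrite ler_wpM2r ?window_count// mulr_ge0.
by rewrite le_eqVlt; apply/orP; left; apply/eqP; ring.
Qed.

(** A Toeplitz form of bandwidth $m$ grouped by lag, by induction on the border row and column. For
    $j>n$ the truncated [n - j] makes the inner sum empty. It serves for $s_n^2$ and for the
    expectations alike. *)
Lemma distn_sum (f z : nat -> R) n m : (forall j, (m <= j)%N -> f j = 0) -> (0 < m)%N ->
  \sum_(i < n) \sum_(j < n) f `|i - j|%N * (z i * z j) =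
  f 0%N * \sum_(i < n) z i * z i
  + 2 * \sum_(1 <= j < m) f j * \sum_(i < n - j) z i * z (i + j)%N.
Proof.
move=> fm m0; elim: n => [|n ih].
  rewrite !big_ord0 mulr0 add0r big1 ?mulr0// => j _.
  by rewrite big_ord0 mulr0.
rewrite big_ord_recr /=.
under eq_bigr do rewrite big_ord_recr /=.
rewrite big_split /= ih big_ord_recr /= distnn.
have -> : \sum_(1 <= j < m) f j * \sum_(i < n.+1 - j) z i * z (i + j)%N =
   \sum_(1 <= j < m) f j * (\sum_(i < n - j) z i * z (i + j)%N) +
   \sum_(i < n) f `|i - n|%N * (z i * z n).
  transitivity (\sum_(1 <= j < m) (f j * (\sum_(i < n - j) z i * z (i + j)%N) +
       (j <= n)%N%:R * (f j * (z (n - j)%N * z n)))).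
    apply: eq_bigr => j _; have [jn|jn] := leqP j n.
      by rewrite subSn// big_ord_recr /= mulrDr mul1r subnK.
    by rewrite mul0r addr0 (_ : n.+1 - j = n - j)%N//; lia.
  rewrite big_split /=; congr (_ + _).
  (* The ranges up to $m$ and up to $n+1$ give the same sum: the indicator removes $j>n$ and [fm]
     removes $j\ge m$. *)
  transitivity (\sum_(1 <= j < n.+1) f j * (z (n - j)%N * z n)).
    have [mn|nm] := leqP m n.
      rewrite (big_cat_nat m0 (leqW mn))/=.
      rewrite [X in _ = _ + X]big_nat [X in _ = _ + X]big1 ?addr0; last first.
        by move=> j /andP[mj _]; rewrite fm// mul0r.
      by apply: eq_big_nat => j /andP[_ jm]; rewrite (_ : (j <= n)%N) ?mul1r//; lia.
    rewrite (big_cat_nat (ltn0Sn n) nm)/=.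
    rewrite [X in _ + X = _]big_nat [X in _ + X = _]big1 ?addr0; last first.
      by move=> j /andP[nj _]; rewrite leqNgt nj mul0r.
    by apply: eq_big_nat => j /andP[_ jm]; rewrite -ltnS jm mul1r.
  rewrite big_add1 /= big_nat_rev /= big_mkord; apply: eq_bigr => i _.
  have := ltn_ord i => il; rewrite add0n (_ : n - (n - i.+1).+1 = i)%N; last by lia.
  by rewrite (_ : `|i - n|%N = (n - i.+1).+1) //; lia.
rewrite big_ord_recr /=.
have -> : \sum_(j < n) f `|n - j|%N * (z n * z j) = \sum_(i < n) f `|i - n|%N * (z i * z n).
  by apply: eq_bigr => i _; rewrite distnC [z n * _]mulrC.
ring.
Qed.

End WindowSums.

(** * Variance of a banded quadratic form *)

Section QuadraticForm.
Context {R : realType} {d : measure_display} {T : measurableType d}.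
Variable P : probability T R.
Local Notation intg := (intg P).
Local Notation Ex := (Ex P).
Local Notation L4 := (L4 P).

Lemma intg_sqr_sum (I : finType) (V : I -> T -> R) :
  (forall p q, intg (fun w => V p w * V q w)) ->
  intg (fun w => (\sum_p V p w) ^+ 2).
Proof.
move=> Vi; rewrite [X in intg X](_ : _ = fun w => \sum_p \sum_q V p w * V q w).
  by apply: intg_sum => p _; exact: intg_sum.
by apply/funext => w; rewrite expr2 mulr_suml; apply: eq_bigr => p _; rewrite mulr_sumr.
Qed.

Lemma Ex_sqr_sum (I : finType) (V : I -> T -> R) :
  (forall p q, intg (fun w => V p w * V q w)) ->
  Ex (fun w => (\sum_p V p w) ^+ 2) = \sum_p \sum_q Ex (fun w => V p w * V q w).
Proof.
move=> Vi; rewrite (@eq_Ex _ _ _ _ _ (fun w => \sum_p \sum_q V p w * V q w)).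
  rewrite Ex_sum; last by move=> p _; exact: intg_sum.
  by apply: eq_bigr => p _; rewrite Ex_sum.
by move=> w; rewrite expr2 mulr_suml; apply: eq_bigr => p _; rewrite mulr_sumr.
Qed.

Definition quad (Y : nat -> T -> R) n (a : nat -> nat -> R) (w : T) : R :=
  \sum_(i < n) \sum_(j < n) a i j * (Y i w * Y j w).

Variables (Y : nat -> T -> R) (gam g : nat -> R) (kap : nat -> nat -> nat -> nat -> R).
Hypothesis YL4 : forall i, L4 (Y i).
Hypothesis Y2 : forall i j, Ex (fun w => Y i w * Y j w) = gam `|i - j|%N.
Hypothesis Y4 : forall i j k l, Ex (fun w => Y i w * Y j w * Y k w * Y l w) =
  gam `|i - j|%N * gam `|k - l|%N + gam `|i - k|%N * gam `|j - l|%N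
  + gam `|i - l|%N * gam `|j - k|%N + kap i j k l.
Hypothesis gam_le : forall h, `|gam h| <= g h.
Hypothesis g_dec : forall h h', (h <= h')%N -> g h' <= g h.

Lemma g_ge0 h : 0 <= g h.
Proof. exact: le_trans (normr_ge0 _) (gam_le h). Qed.

Lemma quad_pair n a w :
  quad Y n a w = \sum_(p : 'I_n * 'I_n) a p.1 p.2 * (Y p.1 w * Y p.2 w).
Proof. by rewrite /quad pair_bigA. Qed.

Lemma intgYY i j : intg (fun w => Y i w * Y j w).
Proof. exact: L4_intg2. Qed.

Lemma intg_quad n a : intg (quad Y n a).
Proof.
rewrite /quad; apply: intg_sum => i _; apply: intg_sum => j _.
by apply: intgZ; exact: intgYY.
Qed.

Lemma Ex_quad n a :
  Ex (quad Y n a) = \sum_(i < n) \sum_(j < n) a i j * gam `|i - j|%N.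
Proof.
rewrite /quad Ex_sum; last first.
  by move=> i _; apply: intg_sum => j _; apply: intgZ; exact: intgYY.
apply: eq_bigr => i _; rewrite Ex_sum; last by move=> j _; apply: intgZ; exact: intgYY.
by apply: eq_bigr => j _; rewrite ExZ ?Y2//; exact: intgYY.
Qed.

Lemma intgYYYY i j k l : intg (fun w => (Y i w * Y j w) * (Y k w * Y l w)).
Proof.
rewrite [X in intg X](_ : _ = fun w => Y i w * Y j w * Y k w * Y l w).
  exact: L4_intg4.
by apply/funext => w; rewrite !mulrA.
Qed.

Let cYY i j w := Y i w * Y j w - gam `|i - j|%N.

Let intg_cYY i j : intg (cYY i j).
Proof. by apply: intgB; [exact: intgYY|exact: intg_cst]. Qed.

Let cYY2E i j k l : (fun w => cYY i j w * cYY k l w) =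
  fun w => (Y i w * Y j w) * (Y k w * Y l w) - (gam `|i - j|%N * cYY k l w
     + gam `|k - l|%N * (Y i w * Y j w)).
Proof. by apply/funext => w; rewrite /cYY; ring. Qed.

Let intg_cYY2 i j k l : intg (fun w => cYY i j w * cYY k l w).
Proof.
rewrite cYY2E; apply: intgB; first exact: intgYYYY.
by apply: intgD; apply: intgZ => //; exact: intgYY.
Qed.

(** Centring the two products cancels the pairing $(ij)(kl)$, the only one that does not decay when
    the pairs are far apart. *)
Let Ex_cYY2 i j k l : Ex (fun w => cYY i j w * cYY k l w) =
  gam `|i - k|%N * gam `|j - l|%N + gam `|i - l|%N * gam `|j - k|%N + kap i j k l.
Proof.
have iYY := intgYY i j; have ikl := intg_cYY k l.
rewrite cYY2E ExB; [|exact: intgYYYY|by apply: intgD; exact: intgZ].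
rewrite ExD; [|exact: intgZ|exact: intgZ].
rewrite !ExZ// Y2 (_ : Ex (cYY k l) = 0); last first.
  rewrite /cYY ExB; [|exact: intgYY|exact: intg_cst].
  by rewrite Y2 Ex_cst subrr.
rewrite (@eq_Ex _ _ _ _ _ (fun w => Y i w * Y j w * Y k w * Y l w)); last first.
  by move=> w; rewrite !mulrA.
rewrite Y4; ring.
Qed.

Lemma quad_centered n a w : quad Y n a w - Ex (quad Y n a) =
  \sum_(p : 'I_n * 'I_n) a p.1 p.2 * cYY p.1 p.2 w.
Proof.
rewrite quad_pair Ex_quad pair_bigA -sumrB.
by apply: eq_bigr => p _; rewrite -mulrBr.
Qed.

Lemma intg_quad_centered_sqr n a : intg (fun w => (quad Y n a w - Ex (quad Y n a)) ^+ 2).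
Proof.
under eq_fun do rewrite quad_centered.
apply: intg_sqr_sum => p q.
rewrite [X in intg X](_ : _ = fun w => (a p.1 p.2 * a q.1 q.2) * (cYY p.1 p.2 w * cYY q.1 q.2 w)).
  exact: intgZ.
by apply/funext => w; ring.
Qed.

(** Exchanging $k$ and $l$ turns the second pairing into the first, whence $32=2\cdot16$. For the
    cumulants the window in $(k,l)$ is dropped: [S] bounds the sum over $k,l$, and at most $2nm$
    pairs $(i,j)$ lie in the window. *)
Lemma variance_quad_le n m (a : nat -> nat -> R) (B S : R) : 0 <= B ->
  (forall i j : 'I_n, `|a i j| <= B * (`|i - j| < m)%N%:R) ->
  (forall i j : 'I_n, \sum_(k < n) \sum_(l < n) `|kap i j k l| <= S) ->
  Ex (fun w => (quad Y n a w - Ex (quad Y n a)) ^+ 2) <=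
  B ^+ 2 * (32 * (n%:R * m%:R * (\sum_(h < n) g h) * (\sum_(h < m) g h))
            + 2 * (n%:R * m%:R * S)).
Proof.
move=> B0 aB kS.
(* For $n=0$ the hypothesis on [S] is vacuous and its sign unknown, hence the guard. *)
have S0 : (0 < n)%N -> 0 <= S.
  move=> n0; apply: le_trans (kS (Ordinal n0) (Ordinal n0)).
  by apply: sumr_ge0 => k _; apply: sumr_ge0.
rewrite (eq_Ex _ (fun w => congr1 (fun x : R => x ^+ 2) (quad_centered n a w))).
rewrite Ex_sqr_sum; last first.
  move=> p q; rewrite [X in intg X](_ : _ =
    fun w => (a p.1 p.2 * a q.1 q.2) * (cYY p.1 p.2 w * cYY q.1 q.2 w)).
    exact: intgZ.
  by apply/funext => w; ring.
pose v (i j : nat) : R := (`|i - j| < m)%N%:R.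
have v0 i j : 0 <= v i j by rewrite /v.
apply: (@le_trans _ _ (\sum_(p : 'I_n * 'I_n) \sum_(q : 'I_n * 'I_n)
   (B ^+ 2 * (v p.1 p.2 * v q.1 q.2) *
   (g `|p.1 - q.1|%N * g `|p.2 - q.2|%N + g `|p.1 - q.2|%N * g `|p.2 - q.1|%N
    + `|kap p.1 p.2 q.1 q.2|)))).
  apply: ler_sum => p _; apply: ler_sum => q _.
  rewrite (@eq_Ex _ _ _ _ _ (fun w => (a p.1 p.2 * a q.1 q.2) *
      (cYY p.1 p.2 w * cYY q.1 q.2 w))); last by move=> w; ring.
  rewrite ExZ// Ex_cYY2 (le_trans (ler_norm _))// normrM.
  apply: ler_pM => //.
    rewrite normrM expr2 mulrACA; exact: ler_pM.
  rewrite (le_trans (ler_normD _ _))// lerD// (le_trans (ler_normD _ _))//.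
  by rewrite !normrM lerD// ler_pM.
rewrite -(pair_bigA _ (fun i j : 'I_n => \sum_(q : 'I_n * 'I_n)
   (B ^+ 2 * (v i j * v q.1 q.2) *
   (g `|i - q.1|%N * g `|j - q.2|%N + g `|i - q.2|%N * g `|j - q.1|%N
    + `|kap i j q.1 q.2|)))) /=.
apply: (@le_trans _ _ (\sum_(i < n) \sum_(j < n) (
   B ^+ 2 * (\sum_(k < n) \sum_(l < n) v i j * v k l * (g `|i - k|%N * g `|j - l|%N))
   + B ^+ 2 * (\sum_(k < n) \sum_(l < n) v i j * v k l * (g `|i - k|%N * g `|j - l|%N))
   + B ^+ 2 * (v i j * S)))).
  apply: ler_sum => i _; apply: ler_sum => j _.
  rewrite -(pair_bigA _ (fun k l : 'I_n => 
   (B ^+ 2 * (v i j * v k l) *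
   (g `|i - k|%N * g `|j - l|%N + g `|i - l|%N * g `|j - k|%N
    + `|kap i j k l|)))) /=.
  have -> : \sum_(k < n) \sum_(l < n) B ^+ 2 * (v i j * v k l) *
     (g `|i - k|%N * g `|j - l|%N + g `|i - l|%N * g `|j - k|%N + `|kap i j k l|) =
     B ^+ 2 * (\sum_(k < n) \sum_(l < n) v i j * v k l * (g `|i - k|%N * g `|j - l|%N))
     + B ^+ 2 * (\sum_(k < n) \sum_(l < n) v i j * v k l * (g `|i - l|%N * g `|j - k|%N))
     + B ^+ 2 * (\sum_(k < n) \sum_(l < n) v i j * v k l * `|kap i j k l|).
    rewrite -!mulrDr -!big_split mulr_sumr; apply: eq_bigr => k _ /=.
    by rewrite -!big_split mulr_sumr; apply: eq_bigr => l _ /=; ring.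
  have B20 : 0 <= B ^+ 2 by rewrite sqr_ge0.
  apply: lerD; first apply: lerD => //.
    rewrite ler_wpM2l// exchange_big; apply: ler_sum => k _; apply: ler_sum => l _.
    by rewrite /v (distnC l k).
  rewrite ler_wpM2l// (le_trans _ (ler_wpM2l (v0 i j) (kS i j)))//.
  rewrite mulr_sumr; apply: ler_sum => k _; rewrite mulr_sumr; apply: ler_sum => l _.
  rewrite -mulrA ler_wpM2l// -[leRHS]mul1r ler_wpM2r//.
  by rewrite /v; case: (`|_ - _| < m)%N; rewrite ?lexx ?ler01.
have -> (F : 'I_n -> 'I_n -> R) : \sum_(i < n) \sum_(j < n)
    (B ^+ 2 * F i j + B ^+ 2 * F i j + B ^+ 2 * (v i j * S)) =
    B ^+ 2 * (2 * \sum_(i < n) \sum_(j < n) F i j + \sum_(i < n) \sum_(j < n) v i j * S).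
  rewrite mulr_sumr -big_split mulr_sumr; apply: eq_bigr => i _ /=.
  by rewrite mulr_sumr -big_split mulr_sumr; apply: eq_bigr => j _ /=; ring.
rewrite ler_wpM2l ?sqr_ge0//.
have h := window_quad_sum n m g_ge0 g_dec.
rewrite /v; apply: lerD; first lra.
have [n0|n0] := posnP n; first by subst n; rewrite big_ord0 !mul0r mulr0.
apply: (@le_trans _ _ (\sum_(i < n) 2 * (m%:R * S))).
  apply: ler_sum => i _; rewrite -mulr_suml [leRHS]mulrA ler_wpM2r ?S0//.
  exact: window_count.
by rewrite sumr_const card_ord -mulr_natl le_eqVlt; apply/orP; left; apply/eqP; ring.
Qed.

End QuadraticForm.

(** * Power majorants of a regularly varying covariance *)

Section PowerSums.
Context {R : realType}.
Implicit Types (a : R) (n : nat).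

(* Young's inequality with exponents 1/a and 1/(1-a) *)
Lemma powR_bernoulli a (y : R) : 0 < a < 1 -> 0 <= y -> y `^ a <= a * y + (1 - a).
Proof.
move=> /andP[a0 a1] y0.
have a1' : 0 < 1 - a by rewrite subr_gt0.
have := @conjugate_powR R (y `^ a) 1 a^-1 (1 - a)^-1 (powR_ge0 _ _) ler01.
rewrite !invr_gt0 => /(_ a0 a1'); rewrite !invrK mulr1 powR1 mul1r.
rewrite -powRrM mulfV ?gt_eqF// powRr1// mulrC; apply.
by rewrite addrC subrK.
Qed.

Lemma powR_sub1_dec a (h h' : nat) : a < 1 -> (h <= h')%N ->
  (h'.+1%:R : R) `^ (a - 1) <= h.+1%:R `^ (a - 1).
Proof.
move=> a1 hh; rewrite -opprB !powRN lef_pV2 ?posrE ?powR_gt0//.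
by apply: ge0_ler_powR; rewrite ?nnegrE ?ler_nat ?subr_ge0// ltW.
Qed.

(** The induction step is $n^a\le x^a-ax^{a-1}$ with $x=n+1$, which is [powR_bernoulli] at
    $y=1-1/x$. *)
Lemma sum_powR_le a n : 0 < a < 1 ->
  \sum_(h < n) (h.+1%:R : R) `^ (a - 1) <= a^-1 * n%:R `^ a.
Proof.
move=> a01; have /andP[a0 a1] := a01; elim: n => [|n ih].
  by rewrite big_ord0 powR0 ?mulr0// gt_eqF.
rewrite big_ord_recr /= (le_trans (lerD ih (lexx _)))//.
set x : R := n.+1%:R; have x0 : 0 < x by rewrite ltr0n.
have nE : n%:R = (1 - x^-1) * x by rewrite mulrBl mul1r mulVf ?gt_eqF// /x -natr1 addrK.
have y0 : 0 <= 1 - x^-1 by rewrite subr_ge0 invf_le1// ler1n.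
have := powR_bernoulli a01 y0.
rewrite nE powRM ?(ltW x0)// -(mulr_powRB1 (ltW x0) a0) => h.
have p0 : 0 < x `^ (a - 1) by rewrite powR_gt0.
rewrite -(ler_pM2l a0) mulrDr !mulrA mulfV ?gt_eqF// !mul1r.
rewrite -!mulrA; move: h p0; set u := (_ `^ a); set p := (x `^ _) => h p0.
have : u * (x * p) <= (a * (1 - x^-1) + (1 - a)) * (x * p).
  by rewrite ler_wpM2r// mulr_ge0 ?ltW.
rewrite (_ : (_ + _) * (x * p) = x * p - a * p); first lra.
by field; rewrite gt_eqF.
Qed.

(** Past some index the ratio is at most 2, and the finitely many earlier terms are absorbed by
    adding their ratios to the constant. The power is taken at $h+1$ because at $h=0$ it would be 0
    by convention and bound nothing. *)
Lemma regular_bound a (c : R) (f : nat -> R) : 0 < a < 1 -> 0 < c ->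
  f j / (c * j%:R `^ (a - 1)) @[j --> \oo] --> (1 : R) ->
  exists2 D : R, 0 <= D & forall h, `|f h| <= D * h.+1%:R `^ (a - 1).
Proof.
move=> /andP[a0 a1] c0 fc.
have /cvgrPdist_lt/(_ 1 ltr01)[N _ HN] := fc.
pose p (j : nat) : R := j.+1%:R `^ (a - 1).
have p0 j : 0 < p j by rewrite powR_gt0.
have F0 : 0 <= \sum_(j < N.+1) `|f j| / p j.
  by apply: sumr_ge0 => j _; rewrite divr_ge0// ltW.
exists (4 * c + \sum_(j < N.+1) `|f j| / p j).
  by rewrite addr_ge0// mulr_ge0// ltW.
move=> h; rewrite -/(p h) mulrDl; have [hN|Nh] := ltnP h N.+1.
  rewrite (bigD1 (Ordinal hN))//= [X in _ <= _ + X]mulrDl divfK ?gt_eqF//.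
  rewrite addrCA lerDl addr_ge0// mulr_ge0// ?(ltW (p0 _))//.
    by rewrite mulr_ge0// ltW.
  by apply: sumr_ge0 => j _; rewrite divr_ge0// ltW.
apply: (@le_trans _ _ (4 * c * p h)); last by rewrite lerDl mulr_ge0// ltW.
have h0 : 0 < h%:R :> R by rewrite ltr0n; lia.
have /= := HN h (ltnW Nh).
set q := h%:R `^ (a - 1); have q0 : 0 < q by rewrite powR_gt0.
have cq0 : 0 < c * q by rewrite mulr_gt0.
(* Since $h\cdot h^{a-1}=h^a\le(h+1)^a=(h+1)(h+1)^{a-1}\le2h(h+1)^{a-1}$. *)
have qp : q <= 2 * p h.
  rewrite -(ler_pM2l h0) mulrCA (mulr_powRB1 (ltW h0) a0).
  have := @mulr_powRB1 R h.+1%:R a (ler0n _ _) a0; rewrite -/(p h).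
  have : h%:R `^ a <= h.+1%:R `^ a :> R.
    by apply: ge0_ler_powR; rewrite ?nnegrE ?ler_nat// ltW.
  have : h.+1%:R <= 2 * h%:R :> R by rewrite -natrM ler_nat; lia.
  move=> k1 k2 k3; apply: (le_trans k2); rewrite -k3 mulrA.
  by apply: ler_wpM2r k1; rewrite ltW.
move=> fq; have : `|f h / (c * q)| <= 2.
  rewrite -[f h / _](subKr 1) (le_trans (ler_normB _ _))// normr1.
  by rewrite (_ : 2 = 1 + 1)// lerD// ltW.
rewrite normrM normfV (gtr0_norm cq0) ler_pdivrMr// => /le_trans; apply.
by have := ler_wpM2l (ltW c0) qp; nra.
Qed.

Lemma sum_shift_le (F : nat -> R) n c M : (forall r, 0 <= F r) -> (n + c <= M)%N ->
  \sum_(k < n) F (k + c)%N <= \sum_(0 <= r < M) F r.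
Proof.
move=> F0 ncM.
rewrite (big_cat_nat (leq0n c) (leq_trans (leq_addl n c) ncM)) /=.
rewrite (big_cat_nat (leq_addl n c) ncM) /= addrCA.
rewrite -{2}[c]add0n big_addn addnK big_mkord lerDl.
by rewrite addr_ge0// sumr_ge0.
Qed.

End PowerSums.

(** * Shift invariance of centred moments and cumulants *)

Section Stationarity.
Context {R : realType} {d : measure_display} {T : measurableType d}.
Variables (P : probability T R) (X : nat -> T -> R).
Hypothesis Xm : forall j, measurable_fun setT (X j).
Hypothesis Xst : fourth_order_stationary P X.
Local Notation intg := (intg P).
Local Notation Ex := (Ex P).
Local Notation L4 := (L4 P).

Let Z i w := X i w - mean P X.

Lemma L4X i : L4 (X i).
Proof.
split => //; have [/(_ i) h _] := Xst; move: h.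
by congr (_.-integrable _ _); apply/funext => w /=; rewrite -normrX ger0_norm ?exprn_even_ge0.
Qed.

Lemma L4Z_centered i : L4 (Z i).
Proof. by apply: L4B; [exact: L4X|exact: L4_cst]. Qed.

Let intgXZ (s t : seq nat) k : (size s + size t <= 4)%N ->
  intg (fun w => \prod_(i <- s) X (i + k)%N w * \prod_(i <- t) Z (i + k)%N w).
Proof.
move=> st.
have := @intg_prod4 _ _ _ P (nat + nat)%type (map inl s ++ map inr t)
  (fun i => match i with inl i => X (i + k)%N | inr i => Z (i + k)%N end).
rewrite size_cat !size_map => /(_ st) h.
rewrite [X in intg X](_ : _ = fun w => \prod_(i <- map inl s ++ map inr t)
  match i with inl i => X (i + k)%N | inr i => Z (i + k)%N end w).
  by apply: h => -[i|i]; [exact: L4X|exact: L4Z_centered].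
by apply/funext => w; rewrite big_cat !big_map.
Qed.

(** Stationarity is given for products of the [X]. Mixed products are what closes the induction:
    writing $Z=X-\mu$ in one factor either moves it to the list [s] or drops it. *)
Lemma centered_shift (t s : seq nat) k : (size s + size t <= 4)%N ->
  Ex (fun w => \prod_(i <- s) X (i + k)%N w * \prod_(i <- t) Z (i + k)%N w) =
  Ex (fun w => \prod_(i <- s) X i w * \prod_(i <- t) Z i w).
Proof.
elim: t s => [|z t ih] s st.
  have [_ /(_ s k)] := Xst; rewrite addn0 in st => /(_ st)/(congr1 fine).
  rewrite !fine_Ex => h.
  by transitivity (Ex (fun w => \prod_(i <- s) X (i + k)%N w)); [|rewrite h];
    apply: eq_Ex => w; rewrite big_nil mulr1.
have st' : (size (z :: s) + size t <= 4)%N by rewrite /= addSnnS.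
have st'' : (size s + size t <= 4)%N by apply: leq_trans st; rewrite /= addnS.
have step l : Ex (fun w => \prod_(i <- s) X (i + l)%N w * \prod_(i <- z :: t) Z (i + l)%N w) =
  Ex (fun w => \prod_(i <- z :: s) X (i + l)%N w * \prod_(i <- t) Z (i + l)%N w)
  - mean P X * Ex (fun w => \prod_(i <- s) X (i + l)%N w * \prod_(i <- t) Z (i + l)%N w).
  have i1 := intgXZ l st'; have i2 := intgXZ l st''.
  rewrite -ExZ// -ExB//; last exact: intgZ.
  by apply: eq_Ex => w; rewrite !big_cons /Z; ring.
rewrite step ih// ih//; have := step 0%N.
under eq_Ex do (under eq_bigr do rewrite addn0; under [X in _ * X]eq_bigr do rewrite addn0).
move=> ->; congr (_ - _ * _); apply: eq_Ex => w.
  by congr (_ * _); apply: eq_bigr => i _; rewrite addn0.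
by congr (_ * _); apply: eq_bigr => i _; rewrite addn0.
Qed.

Lemma prodZ_shift (t : seq nat) k : (size t <= 4)%N ->
  Ex (fun w => \prod_(i <- t) Z (i + k)%N w) = Ex (fun w => \prod_(i <- t) Z i w).
Proof.
move=> t4; have := @centered_shift t [::] k t4.
have e (F : T -> R) : (fun w => \prod_(i <- [::]) X i w * F w) = F.
  by apply/funext => w; rewrite big_nil mul1r.
have e' (F : T -> R) : (fun w => \prod_(i <- [::]) X (i + k)%N w * F w) = F.
  by apply/funext => w; rewrite big_nil mul1r.
by rewrite e e'.
Qed.

Lemma cov_centered i j :
  Ex (fun w => Z i w * Z j w) = gamma P X `|i - j|%N.
Proof.
wlog ij : i j / (i <= j)%N => [h|].
  have [ij|/ltnW ji] := leqP i j; first exact: h.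
  by rewrite distnC -h//; apply: eq_Ex => w; rewrite mulrC.
rewrite /gamma fine_Ex.
have := @prodZ_shift [:: 0%N; (j - i)%N] i isT.
have e (f g : nat) : (fun w => \prod_(l <- [:: f; g]) Z l w) = (fun w => Z f w * Z g w).
  by apply/funext => w; rewrite !big_cons big_nil mulr1.
have e' (f g : nat) : (fun w => \prod_(l <- [:: f; g]) Z (l + i) w) = (fun w => Z (f + i)%N w * Z (g + i)%N w).
  by apply/funext => w; rewrite !big_cons big_nil mulr1.
rewrite e e' add0n subnK// => ->.
by rewrite /= (_ : `|i - j|%N = (j - i)%N)//; lia.
Qed.

Lemma gamma_abs (h : int) : gamma P X h = gamma P X `|h|%N.
Proof. by []. Qed.

(** The cumulant is based at the index [b], the moment at [i]. A shift by $b-i$ may be negative, so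
    both are shifted forward to the common base $i+b$. *)
Lemma moment4_centered (i j k l : nat) :
  Ex (fun w => Z i w * Z j w * Z k w * Z l w) =
  gamma P X `|i - j|%N * gamma P X `|k - l|%N + gamma P X `|i - k|%N * gamma P X `|j - l|%N
  + gamma P X `|i - l|%N * gamma P X `|j - k|%N
  + kappa P X (j%:Z - i%:Z) (k%:Z - i%:Z) (l%:Z - i%:Z).
Proof.
rewrite /kappa; set b := (_ + _ + _)%N.
rewrite (gamma_abs (j%:Z - i%:Z)) (gamma_abs (k%:Z - i%:Z)) (gamma_abs (l%:Z - i%:Z)).
rewrite (gamma_abs (k%:Z - i%:Z - _)) (gamma_abs (j%:Z - i%:Z - (l%:Z - i%:Z))).
rewrite (gamma_abs (j%:Z - i%:Z - (k%:Z - i%:Z))).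
rewrite (_ : absz (k%:Z - i%:Z - (l%:Z - i%:Z))%R = `|k - l|%N); last lia.
rewrite (_ : absz (j%:Z - i%:Z - (l%:Z - i%:Z))%R = `|j - l|%N); last lia.
rewrite (_ : absz (j%:Z - i%:Z - (k%:Z - i%:Z))%R = `|j - k|%N); last lia.
rewrite (distnC i j) (distnC i k) (distnC i l) fine_Ex.
set M := Ex _; set M' := Ex _; suff -> : M = M' by ring.
have := @prodZ_shift [:: i; j; k; l] b isT.
(* The indices in [kappa]; shifted by [i] they become $i,j,k,l$ shifted by [b]. *)
pose t := [:: b; absz (b%:Z + (j%:Z - i%:Z))%R; absz (b%:Z + (k%:Z - i%:Z))%R; absz (b%:Z + (l%:Z - i%:Z))%R].
have := @prodZ_shift t i isT.
have e (f g u v s : nat) : (fun w => \prod_(l <- [:: f; g; u; v]) Z (l + s) w) =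
   (fun w => Z (f + s)%N w * Z (g + s)%N w * Z (u + s)%N w * Z (v + s)%N w).
  by apply/funext => w; rewrite !big_cons big_nil mulr1 !mulrA.
have e' (f g u v : nat) : (fun w => \prod_(l <- [:: f; g; u; v]) Z l w) =
   (fun w => Z f w * Z g w * Z u w * Z v w).
  by apply/funext => w; rewrite !big_cons big_nil mulr1 !mulrA.
rewrite /t !e !e'.
rewrite (_ : absz (b%:Z + (j%:Z - i%:Z))%R + i = j + b)%N; last by rewrite /b; lia.
rewrite (_ : absz (b%:Z + (k%:Z - i%:Z))%R + i = k + b)%N; last by rewrite /b; lia.
rewrite (_ : absz (b%:Z + (l%:Z - i%:Z))%R + i = l + b)%N; last by rewrite /b; lia.
by rewrite (addnC b i) => -> h; rewrite /M -h /M' /Z addr0.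
Qed.

(** Differences $k-i$ and $l-i$ lie in $[-n,n]$, at position $k+(n-i)$ of the range starting at
    $-n$. Uniformity in the first argument covers $h=j-i$. *)
Lemma kappa_sum_le (C a : R) (N : nat) :
  (forall (n : nat) (h : int), (N <= n)%N ->
     \sum_(0 <= r < (n.*2).+1) \sum_(0 <= s < (n.*2).+1)
        `|kappa P X h (r%:Z - n%:Z) (s%:Z - n%:Z)| <= C * n%:R `^ a) ->
  forall n, (N <= n)%N -> forall i j : 'I_n, \sum_(k < n) \sum_(l < n)
    `|kappa P X (j%:Z - i%:Z) (k%:Z - i%:Z) (l%:Z - i%:Z)| <= C * n%:R `^ a.
Proof.
move=> hC n Nn i j; apply: le_trans (hC n (j%:Z - i%:Z) Nn).
have il := ltn_ord i.
have ni : (n + (n - i) <= n.*2.+1)%N by lia.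
apply: le_trans (sum_shift_le _ ni); last by move=> r; apply: sumr_ge0.
apply: ler_sum => k _; apply: le_trans (sum_shift_le _ ni) => //.
apply: ler_sum => l _; rewrite le_eqVlt; apply/orP; left; apply/eqP.
by congr `|kappa _ _ _ _ _|; lia.
Qed.

End Stationarity.

(** * Mean, fluctuation and recentring of the long-run variance estimator *)

Section LongRunVariance.
Context {R : realType} {d : measure_display} {T : measurableType d}.
Variable P : probability T R.
Local Notation intg := (intg P).
Local Notation Ex := (Ex P).
Local Notation L4 := (L4 P).
Variables (Y : nat -> T -> R) (gam g : nat -> R) (kap : nat -> nat -> nat -> nat -> R).
Hypothesis YL4 : forall i, L4 (Y i).
Hypothesis Y2 : forall i j, Ex (fun w => Y i w * Y j w) = gam `|i - j|%N.
Hypothesis Y4 : forall i j k l, Ex (fun w => Y i w * Y j w * Y k w * Y l w) =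
  gam `|i - j|%N * gam `|k - l|%N + gam `|i - k|%N * gam `|j - l|%N
  + gam `|i - l|%N * gam `|j - k|%N + kap i j k l.
Hypothesis gam_le : forall h, `|gam h| <= g h.
Hypothesis g_dec : forall h h', (h <= h')%N -> g h' <= g h.
Variables (a K C : R) (N : nat).
Hypothesis a01 : 0 < a < 1.
Hypothesis gK : forall n, \sum_(h < n) g h <= K * n%:R `^ a.
Hypothesis kapC : forall n, (N <= n)%N -> forall i j : 'I_n,
  \sum_(k < n) \sum_(l < n) `|kap i j k l| <= C * n%:R `^ a.

Let a0 : 0 < a. Proof. by case/andP: a01. Qed.
Let a1 : a < 1. Proof. by case/andP: a01. Qed.
Let g0 h : 0 <= g h. Proof. exact: (g_ge0 gam_le). Qed.

Let pw_ge1 (m : nat) : (0 < m)%N -> 1 <= m%:R `^ a :> R.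
Proof.
move=> m0; rewrite -[leLHS](powRr0 (m%:R : R)).
by apply: ler_powR; rewrite ?ler1n// ltW.
Qed.

Let K0 : 0 <= K.
Proof.
have := gK 1; rewrite big_ord_recl big_ord0 addr0 powR1 mulr1.
exact: le_trans.
Qed.

Let Sn n w := \sum_(i < n) Y i w.
Definition sum_var n : R := \sum_(i < n) \sum_(j < n) gam `|i - j|%N.

Lemma sqr_sum_quad n w : (\sum_(i < n) Y i w) ^+ 2 = quad Y n (fun _ _ => 1) w.
Proof.
rewrite /quad expr2 mulr_suml; apply: eq_bigr => i _; rewrite mulr_sumr.
by apply: eq_bigr => j _; rewrite mul1r.
Qed.

Lemma Ex_sqr_partial_sum n : Ex (fun w => (\sum_(i < n) Y i w) ^+ 2) = sum_var n.
Proof.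
rewrite (eq_Ex _ (sqr_sum_quad n)) (Ex_quad YL4 Y2).
by apply: eq_bigr => i _; apply: eq_bigr => j _; rewrite mul1r.
Qed.

Lemma Ex_quad_le n (b : nat -> nat -> R) (B : R) : 0 <= B ->
  (forall i j : 'I_n, `|b i j| <= B) ->
  `|Ex (quad Y n b)| <= B * (n%:R * (2 * (K * n%:R `^ a))).
Proof.
move=> B0 bB; rewrite (Ex_quad YL4 Y2).
apply: (@le_trans _ _ (\sum_(i < n) B * (2 * (K * n%:R `^ a)))); last first.
  by rewrite sumr_const card_ord -mulr_natl le_eqVlt; apply/orP; left; apply/eqP; ring.
rewrite (le_trans (ler_norm_sum _ _ _))//; apply: ler_sum => i _.
rewrite (le_trans (ler_norm_sum _ _ _))//.
apply: (@le_trans _ _ (\sum_(j < n) B * g `|i - j|%N)).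
  by apply: ler_sum => j _; rewrite normrM ler_pM.
rewrite -mulr_sumr ler_wpM2l// (le_trans (sum_dist i g0))//.
by rewrite ler_wpM2l.
Qed.

Lemma sum_var_ge0 n : 0 <= sum_var n.
Proof. by rewrite -Ex_sqr_partial_sum; apply: Ex_ge0 => w; exact: sqr_ge0. Qed.

Lemma sum_var_le n : sum_var n <= n%:R * (2 * (K * n%:R `^ a)).
Proof.
rewrite -Ex_sqr_partial_sum (eq_Ex _ (sqr_sum_quad n)) (le_trans (ler_norm _))//.
by rewrite (le_trans (@Ex_quad_le n (fun _ _ => 1) 1 ler01 _)) ?mul1r// => i j; rewrite normr1.
Qed.

Let V0 : R := 32 * K ^+ 2 + 2 * `|C|.

(** As $m^a\ge1$, the cumulant term of order $nm\,n^a$ fits under the order $nm\,n^am^a$ of the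
    pairings; this is the origin of [V0]. *)
Lemma variance_quad_rate n m (b : nat -> nat -> R) (B : R) :
  (N <= n)%N -> (0 < m)%N -> 0 <= B ->
  (forall i j : 'I_n, `|b i j| <= B * (`|i - j| < m)%N%:R) ->
  Ex (fun w => (quad Y n b w - Ex (quad Y n b)) ^+ 2) <=
  B ^+ 2 * (V0 * (n%:R * m%:R * n%:R `^ a * m%:R `^ a)).
Proof.
move=> Nn m0 B0 bB.
have kS i j := kapC Nn i j.
apply: (le_trans (variance_quad_le YL4 Y2 Y4 gam_le g_dec B0 bB kS)).
rewrite ler_wpM2l ?sqr_ge0//.
set nm : R := n%:R * m%:R; have nm0 : 0 <= nm by rewrite mulr_ge0.
set na := n%:R `^ a; set ma := m%:R `^ a.
have na0 : 0 <= na by exact: powR_ge0.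
have ma1 : 1 <= ma by exact: pw_ge1.
have sg k : 0 <= \sum_(h < k) g h by apply: sumr_ge0.
rewrite /V0 [leRHS]mulrDl; apply: lerD.
  apply: (@le_trans _ _ (32 * (nm * (K * na) * (K * ma)))).
    rewrite ler_wpM2l//; apply: ler_pM => //; first by rewrite mulr_ge0.
    by rewrite ler_wpM2l.
  by rewrite le_eqVlt; apply/orP; left; apply/eqP; ring.
have Cna : C * na <= `|C| * na * ma.
  apply: (@le_trans _ _ (`|C| * na)); first by rewrite ler_wpM2r// ler_norm.
  by rewrite ler_peMr// mulr_ge0.
apply: (@le_trans _ _ (2 * (nm * (`|C| * na * ma)))).
  by rewrite ler_wpM2l// ler_wpM2l.
by rewrite le_eqVlt; apply/orP; left; apply/eqP; ring.
Qed.

Lemma intg_partial_sum4 n : intg (fun w => (\sum_(i < n) Y i w) ^+ 4).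
Proof. by have [] := @L4_sum _ _ _ P _ (index_enum 'I_n) xpredT _ (fun i _ => YL4 i). Qed.

(** $S^2$ is the form with unit weights and window $n$, and $E S^4=\mathrm{Var}(S^2)+(E S^2)^2$; the
    second term is at most $(2K\,n\,n^a)^2$. *)
Lemma Ex_partial_sum4_le n : (N <= n)%N -> (0 < n)%N ->
  Ex (fun w => (\sum_(i < n) Y i w) ^+ 4) <= (V0 + 4 * K ^+ 2) * (n%:R * n%:R `^ a) ^+ 2.
Proof.
move=> Nn n0; have := @variance_quad_rate n n (fun _ _ => 1) 1 Nn n0 ler01.
have qE : quad Y n (fun _ _ => 1) = (fun w => (\sum_(i < n) Y i w) ^+ 2).
  by apply/funext => w; rewrite sqr_sum_quad.
rewrite qE Ex_sqr_partial_sum expr1n mul1r => h.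
have {}h := h (fun i j => _).
have i2 : intg (fun w => (\sum_(i < n) Y i w) ^+ 2).
  by rewrite -qE; exact: (intg_quad YL4).
have e : Ex (fun w => ((\sum_(i < n) Y i w) ^+ 2 - sum_var n) ^+ 2) =
    Ex (fun w => (\sum_(i < n) Y i w) ^+ 4) - sum_var n ^+ 2.
  rewrite (@eq_Ex _ _ _ _ _ (fun w => (\sum_(i < n) Y i w) ^+ 4 -
     (2 * sum_var n * (\sum_(i < n) Y i w) ^+ 2 - sum_var n ^+ 2))); last by move=> w; ring.
  have ic := intg_cst P (sum_var n ^+ 2); have i2' := intgZ (2 * sum_var n) i2.
  rewrite ExB//; [|exact: intg_partial_sum4|exact: intgB].
  by rewrite ExB// ExZ// Ex_cst Ex_sqr_partial_sum; ring.
have := sum_var_le n; set s := sum_var n in h e *.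
have s0 : 0 <= s by exact: sum_var_ge0.
set u := n%:R * n%:R `^ a => su.
have : s ^+ 2 <= (2 * K * u) ^+ 2.
  have su' : s <= 2 * K * u by apply: (le_trans su); rewrite /u; nra.
  by apply: (lerXn2r _ _ _ su'); rewrite nnegrE// (le_trans s0).
have : Ex (fun w => (\sum_(i < n) Y i w) ^+ 4) - s ^+ 2 <= V0 * u ^+ 2.
  rewrite -e; apply: le_trans (h _) _.
    move=> i j; rewrite normr1 mul1r (_ : (_ < _)%N) ?lexx//.
    by have := ltn_ord i; have := ltn_ord j; lia.
  by rewrite /u le_eqVlt; apply/orP; left; apply/eqP; ring.
by move=> h1 h2; nra.
Qed.

(* [m] times the Bartlett weight when [m = q + 1]: the truncated subtraction
   makes it vanish outside the window. *)
Definition bw m i j : R := (m - `|i - j|)%N%:R.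

Lemma bw_le m i j : `|bw m i j| <= m%:R * (`|i - j| < m)%N%:R.
Proof.
rewrite /bw normr_nat; case: ltnP => h; first by rewrite mulr1 ler_nat leq_subr.
by rewrite mulr0 (_ : (m - _ = 0)%N)//; lia.
Qed.

Lemma bw_ge0 m i j : 0 <= bw m i j.
Proof. by rewrite ler0n. Qed.

Lemma bw_sum_le m n (i : nat) : \sum_(j < n) bw m i j <= 2 * m%:R ^+ 2.
Proof.
apply: (@le_trans _ _ (\sum_(j < n) m%:R * (`|i - j| < m)%N%:R)).
  by apply: ler_sum => j _; exact: le_trans (ler_norm _) (bw_le _ _ _).
rewrite -mulr_sumr expr2 mulrCA ler_wpM2l//.
exact: window_count.
Qed.

(** By lag, the two sides differ only in the count: $n-j$ against $n$. The defect $n-(n-j)$ is at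
    most $j\le m$, also when the subtraction truncates, and the weight is at most $m$. *)
Lemma Ex_quad_bw_le n m : (0 < m)%N ->
  `|Ex (quad Y n (bw m)) - n%:R * sum_var m| <= m%:R ^+ 2 * (2 * (K * m%:R `^ a)).
Proof.
move=> m0; rewrite (Ex_quad YL4 Y2).
have e1 : \sum_(i < n) \sum_(j < n) bw m i j * gam `|i - j|%N =
  m%:R * gam 0%N * n%:R + 2 * \sum_(1 <= j < m) (m - j)%:R * gam j * (n - j)%:R.
  have := @distn_sum R (fun h => (m - h)%:R * gam h) (fun=> 1) n m.
  rewrite subn0 => h; have {}h := h _ m0.
  transitivity (\sum_(i < n) \sum_(j < n) (m - `|i - j|)%N%:R * gam `|i - j|%N * (1 * 1)).
    by apply: eq_bigr => i _; apply: eq_bigr => j _; rewrite !mulr1.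
  rewrite h; last by move=> j mj; rewrite (_ : (m - j = 0)%N) ?mul0r//; lia.
  rewrite !mulr1 sumr_const card_ord; congr (_ + _ * _).
  by apply: eq_bigr => j _; rewrite sumr_const card_ord.
have e2 : sum_var m = gam 0%N * m%:R + 2 * \sum_(1 <= j < m) gam j * (m - j)%:R.
  have := @distn_sum R (fun h => (h < m)%N%:R * gam h) (fun=> 1) m m.
  move=> h; have {}h := h _ m0.
  transitivity (\sum_(i < m) \sum_(j < m) (`|i - j| < m)%N%:R * gam `|i - j|%N * (1 * 1)).
    apply: eq_bigr => i _; apply: eq_bigr => j _; rewrite !mulr1.
    rewrite (_ : (_ < _)%N) ?mul1r//.
    by have := ltn_ord i; have := ltn_ord j; lia.
  rewrite h; last by move=> j mj; rewrite ltnNge mj mul0r.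
  rewrite m0 !mulr1 mul1r sumr_const card_ord; congr (_ + _ * _).
  by apply: eq_big_nat => j /andP[_ jm]; rewrite jm mul1r sumr_const card_ord.
rewrite e1 e2 (_ : _ - _ = - (2 * \sum_(1 <= j < m) (m - j)%:R * gam j * (n%:R - (n - j)%:R))).
  rewrite normrN normrM ger0_norm// mulrCA ler_wpM2l//.
  rewrite (le_trans (ler_norm_sum _ _ _))//.
  apply: (@le_trans _ _ (\sum_(1 <= j < m) m%:R ^+ 2 * g j)).
    apply: ler_sum_nat => j /andP[_ jm].
    rewrite (_ : m%:R ^+ 2 * g j = m%:R * g j * m%:R); last by ring.
    rewrite 2!normrM normr_nat; apply: ler_pM => //.
      by apply: ler_pM => //; rewrite ler_nat leq_subr.
    rewrite ger0_norm ?subr_ge0 ?ler_nat ?leq_subr// lerBlDl -natrD ler_nat; lia.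
  rewrite -mulr_sumr ler_wpM2l ?sqr_ge0// (le_trans _ (gK m))//.
  rewrite -(big_mkord xpredT) [leRHS]big_ltn//= lerDr//.
rewrite [X in _ = - (2 * X)](_ : _ = n%:R * (\sum_(1 <= j < m) gam j * (m - j)%:R)
    - \sum_(1 <= j < m) (m - j)%:R * gam j * (n - j)%:R); first by ring.
by rewrite mulr_sumr -sumrB; apply: eq_bigr => j _; ring.
Qed.

(** Symmetry of [bw] makes the two cross terms both equal to $yL$. *)
Lemma quad_recentre n m w : (0 < n)%N ->
  let L := \sum_(i < n) (\sum_(j < n) bw m i j) * Y i w in
  let y := n%:R^-1 * Sn n w in
  quad (fun i w => Y i w - n%:R^-1 * Sn n w) n (bw m) w - quad Y n (bw m) w =
  (\sum_(i < n) \sum_(j < n) bw m i j) * y ^+ 2 - 2 * (y * L).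
Proof.
move=> n0 L y; rewrite -/y /quad.
have LE : L = \sum_(i < n) \sum_(j < n) bw m i j * Y j w.
  rewrite exchange_big; apply: eq_bigr => i _; rewrite mulr_suml.
  by apply: eq_bigr => j _; rewrite /bw distnC.
have LE' : L = \sum_(i < n) \sum_(j < n) bw m i j * Y i w.
  by apply: eq_bigr => i _; rewrite mulr_suml.
have D2 (F G : nat -> nat -> R) : \sum_(i < n) \sum_(j < n) (F i j - G i j) =
    \sum_(i < n) \sum_(j < n) F i j - \sum_(i < n) \sum_(j < n) G i j.
  by rewrite -sumrB; apply: eq_bigr => i _; rewrite -sumrB.
have M2 (F : nat -> nat -> R) x : \sum_(i < n) \sum_(j < n) x * F i j =
    x * \sum_(i < n) \sum_(j < n) F i j.
  by rewrite mulr_sumr; apply: eq_bigr => i _; rewrite mulr_sumr.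
rewrite -(D2 (fun i j => bw m i j * ((Y i w - y) * (Y j w - y))) (fun i j => bw m i j * (Y i w * Y j w))).
transitivity (\sum_(i < n) \sum_(j < n)
    (y ^+ 2 * bw m i j - y * (bw m i j * Y i w) - y * (bw m i j * Y j w))).
  by apply: eq_bigr => i _; apply: eq_bigr => j _; rewrite /y; ring.
rewrite (D2 (fun i j => y ^+ 2 * bw m i j - y * (bw m i j * Y i w)) (fun i j => y * (bw m i j * Y j w))).
rewrite (D2 (fun i j => y ^+ 2 * bw m i j) (fun i j => y * (bw m i j * Y i w))) (M2 (bw m)).
rewrite (M2 (fun i j => bw m i j * Y i w)) (M2 (fun i j => bw m i j * Y j w)) -LE -LE'.
ring.
Qed.

Let L4S n : L4 (Sn n).
Proof. exact: (@L4_sum _ _ _ P _ (index_enum 'I_n) xpredT _ (fun i _ => YL4 i)). Qed.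

Lemma L4_centred n i : L4 (fun w => Y i w - n%:R^-1 * Sn n w).
Proof. by apply: L4B => //; exact: L4Z. Qed.

(** The cross term is split by $2|yL|\le\lambda y^2+L^2/\lambda$ with $\lambda=2nm^2$, a bound for
    the total weight. The $y^2$ terms then give $8K$ and the $L^2$ term $4K$, in units of
    $m^2n^a$. *)
Lemma Ex_quad_recentre_le n m : (0 < n)%N -> (0 < m)%N ->
  Ex (fun w => `|quad (fun i w => Y i w - n%:R^-1 * Sn n w) n (bw m) w - quad Y n (bw m) w|)
  <= 12 * K * (m%:R ^+ 2 * n%:R `^ a).
Proof.
move=> n0 m0.
set W := fun i : nat => \sum_(j < n) bw m i j.
pose L w := \sum_(i < n) W i * Y i w.
have n0' : 0 < n%:R :> R by rewrite ltr0n.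
have m0' : 0 < m%:R :> R by rewrite ltr0n.
pose la : R := n%:R * (2 * m%:R ^+ 2).
have la0 : 0 < la by rewrite !mulr_gt0// exprn_gt0.
have W0 i : 0 <= W i by apply: sumr_ge0 => j _; exact: bw_ge0.
have WW : \sum_(i < n) W i <= la.
  apply: (@le_trans _ _ (\sum_(i < n) 2 * m%:R ^+ 2)).
    by apply: ler_sum => i _; exact: bw_sum_le.
  by rewrite sumr_const card_ord -[leLHS]mulr_natl.
have L2 w : L w ^+ 2 = quad Y n (fun i j => W i * W j) w.
  rewrite /quad expr2 mulr_suml; apply: eq_bigr => i _; rewrite mulr_sumr.
  by apply: eq_bigr => j _; ring.
have iL : intg (fun w => L w ^+ 2).
  under eq_fun do rewrite L2.
  exact: (intg_quad YL4).
have iS : intg (fun w => Sn n w ^+ 2).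
  under eq_fun do rewrite sqr_sum_quad.
  exact: (intg_quad YL4).
apply: (@le_trans _ _ (Ex (fun w => (2 * la / n%:R ^+ 2) * Sn n w ^+ 2 + la^-1 * L w ^+ 2))).
  apply: le_Ex.
  - apply: intg_norm; apply: intgB; last exact: (intg_quad YL4).
    exact: (intg_quad (L4_centred n)).
  - by apply: intgD; exact: intgZ.
  move=> w; rewrite quad_recentre//= -/(L w) -/(Sn n w).
  set s := Sn n w; set l := L w; set y := n%:R^-1 * s.
  have -> : 2 * la / n%:R ^+ 2 * s ^+ 2 = la * y ^+ 2 + la * y ^+ 2.
    by rewrite /y; field; rewrite gt_eqF.
  rewrite (le_trans (ler_normB _ _))// -addrA lerD//.
    rewrite normrM ger0_norm; last by apply: sumr_ge0 => i _; exact: W0.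
    by rewrite ger0_norm ?sqr_ge0// ler_wpM2r ?sqr_ge0.
  have -> : la^-1 * l ^+ 2 = la * (l / la) ^+ 2 by field; rewrite gt_eqF.
  have -> : 2 * (y * l) = la * (2 * (y * (l / la))) by field; rewrite gt_eqF.
  rewrite normrM gtr0_norm// -mulrDr ler_wpM2l ?(ltW la0)//.
  by rewrite ler_norml; have := sqr_ge0 (y - l / la); have := sqr_ge0 (y + l / la);
    move: (l / la) => x h1 h2; apply/andP; split; nra.
rewrite ExD; [|exact: intgZ|exact: intgZ].
rewrite !ExZ// Ex_sqr_partial_sum (eq_Ex _ L2).
have LL : `|Ex (quad Y n (fun i j => W i * W j))| <= (2 * m%:R ^+ 2) ^+ 2 * (n%:R * (2 * (K * n%:R `^ a))).
  apply: Ex_quad_le; first by rewrite exprn_ge0// mulr_ge0// exprn_ge0.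
  move=> i j; rewrite ger0_norm ?mulr_ge0// expr2; apply: ler_pM => //; exact: bw_sum_le.
have {}LL := le_trans (ler_norm _) LL.
have SS := sum_var_le n.
set na := n%:R `^ a in LL SS *.
have -> : 12 * K * (m%:R ^+ 2 * na) =
  2 * la / n%:R ^+ 2 * (n%:R * (2 * (K * na))) +
  la^-1 * ((2 * m%:R ^+ 2) ^+ 2 * (n%:R * (2 * (K * na)))).
  by rewrite /la; field; rewrite !gt_eqF.
apply: lerD; rewrite ler_wpM2l// ?invr_ge0 ?(ltW la0)//.
by rewrite divr_ge0 ?exprn_ge0// mulr_ge0// ltW.
Qed.

(** Three errors divided by $nm\,m^a$: recentring gives $12Kr$, the bias $2Km/n\le2Kr$ because $m\le
    n$, and the fluctuation $\sqrt{V_0r}$. The rate is $r=(m/n)^{1-a}$. *)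
Lemma long_run_variance_L1 n m : (N <= n)%N -> (0 < m)%N -> (m <= n)%N ->
  let r := m%:R / n%:R * (n%:R `^ a / m%:R `^ a) in is_true (
  Ex (fun w => `|quad (fun i w => Y i w - n%:R^-1 * Sn n w) n (bw m) w
                  / (n%:R * m%:R * m%:R `^ a) - sum_var m / (m%:R * m%:R `^ a)|)
  <= 14 * K * r + Num.sqrt (V0 * r)).
Proof.
move=> Nn m0 mn r; have n0 : (0 < n)%N by apply: leq_trans mn.
have n0' : 0 < n%:R :> R by rewrite ltr0n.
have m0' : 0 < m%:R :> R by rewrite ltr0n.
set z := fun (i : nat) (w : T) => _.
have na0 : 0 < n%:R `^ a :> R by rewrite powR_gt0.
have ma0 : 0 < m%:R `^ a :> R by rewrite powR_gt0.
set na := n%:R `^ a in r na0 *; set ma := m%:R `^ a in r ma0 *.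
have mna : ma <= na by apply: ge0_ler_powR; rewrite ?nnegrE ?ler_nat// ltW.
pose c : R := (n%:R * m%:R * ma)^-1.
have c0 : 0 < c by rewrite invr_gt0 !mulr_gt0.
pose Q := quad Y n (bw m).
have iz : intg (quad z n (bw m)) by exact: (intg_quad (L4_centred n)).
have iQ : intg Q by exact: (intg_quad YL4).
have iA : intg (fun w => `|quad z n (bw m) w - Q w|) by apply: intg_norm; exact: intgB.
have iB : intg (fun w => Q w - Ex Q) by apply: intgB => //; exact: intg_cst.
have iB' : intg (fun w => `|Q w - Ex Q|) by exact: intg_norm.
have iAB := intgD iA iB'.
pose e := `|Ex Q - n%:R * sum_var m|.
have iE := intg_cst P e.
apply: (@le_trans _ _ (Ex (fun w => c * (`|quad z n (bw m) w - Q w| + `|Q w - Ex Q| + e)))).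
  apply: le_Ex.
  - apply: intg_norm; apply: intgB; last exact: intg_cst.
    under eq_fun do rewrite mulrC.
    exact: intgZ.
  - by apply: intgZ; exact: intgD.
  move=> w; rewrite [X in `|X|](_ : _ = c * ((quad z n (bw m) w - Q w) + (Q w - Ex Q)
    + (Ex Q - n%:R * sum_var m))).
    rewrite normrM (gtr0_norm c0) ler_wpM2l ?(ltW c0)//.
    by rewrite (le_trans (ler_normD _ _))// lerD// ler_normD.
  by rewrite /c; field; rewrite !gt_eqF.
rewrite ExZ; last exact: intgD.
rewrite ExD// ExD// Ex_cst.
have hA := Ex_quad_recentre_le n0 m0; rewrite -/z -/Q -/na in hA.
have hB : Ex (fun w => `|Q w - Ex Q|) <= Num.sqrt (m%:R ^+ 2 * (V0 * (n%:R * m%:R * na * ma))).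
  apply: (le_trans (Ex_norm_le_sqrt iB (intg_quad_centered_sqr YL4 Y2 n (bw m)))).
  rewrite ler_wsqrtr//; apply: variance_quad_rate => // i j; exact: bw_le.
have hE : e <= m%:R ^+ 2 * (2 * (K * ma)) by exact: Ex_quad_bw_le.
have V00 : 0 <= V0 by rewrite /V0 addr_ge0// mulr_ge0// exprn_ge0.
have hB' : c * Num.sqrt (m%:R ^+ 2 * (V0 * (n%:R * m%:R * na * ma))) = Num.sqrt (V0 * r).
  rewrite -[c](ger0_norm (ltW c0)) -sqrtr_sqr -sqrtrM ?sqr_ge0//; congr Num.sqrt.
  by rewrite /c /r; field; rewrite !gt_eqF.
rewrite !mulrDr.
have hA' : c * (12 * K * (m%:R ^+ 2 * na)) = 12 * K * r.
  by rewrite /c /r; field; rewrite !gt_eqF.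
have hE' : c * (m%:R ^+ 2 * (2 * (K * ma))) <= 2 * K * r.
  have -> : c * (m%:R ^+ 2 * (2 * (K * ma))) = 2 * K * (m%:R / n%:R).
    by rewrite /c; field; rewrite !gt_eqF.
  rewrite ler_wpM2l ?mulr_ge0// /r ler_peMr ?divr_ge0//.
  by rewrite ler_pdivlMr// mul1r.
have := ler_wpM2l (ltW c0) hA; have := ler_wpM2l (ltW c0) hB; have := ler_wpM2l (ltW c0) hE.
rewrite hA' hB' => h1 h2 h3.
rewrite (_ : 14 * K * r = 12 * K * r + 2 * K * r); last by ring.
by lra.
Qed.

End LongRunVariance.

(** * Laplace transform of a squared standard normal variable *)

Section GaussianTransform.
Context {R : realType}.
Local Notation mu := (@lebesgue_measure R).

(** The Radon-Nikodym derivative of the normal law agrees almost everywhere with its density. *)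
Lemma integral_normal_prob (m s : R) (f : R -> \bar R) U :
  measurable U -> measurable_fun U f ->
  (\int[normal_prob m s]_(x in U) `|f x| < +oo)%E ->
  (\int[normal_prob m s]_(x in U) f x =
   \int[mu]_(x in U) (f x * (normal_pdf m s x)%:E))%E.
Proof.
move=> mU mf finf.
rewrite -(Radon_Nikodym_change_of_variables (normal_prob_dominates m s))//=; last first.
  by apply/integrableP; split.
apply: ae_eq_integral => //.
- apply: emeasurable_funM => //; apply: (measurable_int mu).
  apply: (integrableS _ _ (@subsetT _ _)) => //=.
  by apply: Radon_Nikodym_integrable; exact: normal_prob_dominates.
- apply: emeasurable_funM => //=; apply/measurableT_comp => //=.
  by apply/measurable_funTS; exact: measurable_normal_pdf.
- apply: ae_eqe_mul2l => /=.
  rewrite Radon_NikodymE//=; first exact: normal_prob_dominates.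
  move=> numu; case: cid => /= h [h1 h2 h3].
  apply: integral_ae_eq => //=.
  + exact: integrableS h2.
  + by apply/measurable_funTS/measurableT_comp =>//; exact: measurable_normal_pdf.
  + by move=> E E01 mE; rewrite -h3.
Qed.

(** The exponents add up to that of variance $1/(1+t)$, so the transform reduces to the total mass
    of another normal density. *)
Lemma normal_pdf_tilt (t x : R) : 0 <= t ->
  expR (- (t * x ^+ 2 / 2)) * normal_pdf 0 1 x =
  (Num.sqrt (1 + t))^-1 * normal_pdf 0 (Num.sqrt (1 + t))^-1 x.
Proof.
move=> t0; have t1 : 0 < 1 + t by rewrite ltr_pwDl.
set s := (Num.sqrt (1 + t))^-1; have s0 : 0 < s by rewrite invr_gt0 sqrtr_gt0.
have s2E : s ^+ 2 = (1 + t)^-1 by rewrite exprVn sqr_sqrtr// ltW.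
rewrite !normal_pdfE ?gt_eqF// /normal_fun !subr0 mulrCA.
rewrite -expRD mulrA; congr (_ * expR _); last first.
  by rewrite s2E expr1n !mulr2n; field; rewrite gt_eqF.
rewrite /normal_peak expr1n mul1r.
rewrite -[s ^+ 2 * pi *+ 2]mulrnAr sqrtrM ?sqr_ge0// sqrtr_sqr gtr0_norm//.
by rewrite invfM mulrA mulfV ?mul1r// gt_eqF.
Qed.

Lemma normal_laplace_sqr (t : R) : 0 <= t ->
  (\int[normal_prob 0 1]_x (expR (- (t * x ^+ 2 / 2)))%:E = ((Num.sqrt (1 + t))^-1)%:E)%E.
Proof.
move=> t0.
have mE : measurable_fun [set: R] (fun x => expR (- (t * x ^+ 2 / 2))).
  apply: measurableT_comp => //; apply: measurableT_comp => //.
  by apply: measurable_funM => //; apply: measurable_funM => //; exact: measurable_funX.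
rewrite integral_normal_prob//; last 2 first.
- exact/measurable_EFinP.
- apply: (@le_lt_trans _ _ (\int[normal_prob 0 1]_x (cst 1 x))%E).
    apply: ge0_le_integral => //=.
      by apply/measurable_EFinP; exact: measurableT_comp.
    move=> x _; rewrite lee_fin ger0_norm ?expR_ge0// -expR0 ler_expR oppr_le0.
    by rewrite divr_ge0// mulr_ge0// sqr_ge0.
  by rewrite integral_cst//= mul1e probability_setT ltry.
under eq_integral do rewrite -EFinM normal_pdf_tilt// EFinM.
rewrite integralZl//; last exact: integrable_normal_pdf.
by rewrite integral_normal_pdf mule1.
Qed.

End GaussianTransform.

(** * The law of fractional Brownian motion at time 1 *)

Section LimitProcess.
Context {R : realType} {d : measure_display} {T : measurableType d}.
Variables (Q : probability T R) (H : R) (W : R -> T -> R).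
Hypotheses (H0 : 0 < H) (WfBm : is_fBm Q H W).

Lemma fBm_law1 (A : set R) : measurable A -> Q (W 1 @^-1` A) = normal_prob 0 1 A.
Proof.
move=> mA; have [_ [_ /(_ [:: (1, 1)])]] := WfBm.
rewrite /= ler01 lexx /= => /(_ isT A mA).
rewrite !big_seq1 /= /fbm_cov powR1 subrr normr0 powR0 ?mulf_neq0 ?gt_eqF//.
rewrite subr0 !mul1r (_ : (1 + 1) / 2 = 1 :> R); last by field.
rewrite sqrtr1 => <-.
by congr (Q _); apply/seteqP; split => w /=; rewrite big_seq1 mul1r in_setE.
Qed.

Lemma fBm_laplace_sqr1 (t : R) : 0 <= t ->
  Ex Q (fun w => expR (- (t * W 1 w ^+ 2 / 2))) = (Num.sqrt (1 + t))^-1.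
Proof.
move=> t0; have [mW _] := WfBm.
have mE : measurable_fun [set: R] (fun x : R => (expR (- (t * x ^+ 2 / 2)))%:E).
  apply/measurable_EFinP; apply: measurableT_comp => //; apply: measurableT_comp => //.
  by apply: measurable_funM => //; apply: measurable_funM => //; exact: measurable_funX.
(* normal_prob lives on measurableTypeR R, a copy of R with another display *)
pose GR := measurableTypeR R; pose f (x : GR) : \bar R := (expR (- (t * x ^+ 2 / 2)))%:E.
have mW' : @measurable_fun _ _ T GR setT (W 1) by exact: mW.
have mf : @measurable_fun _ _ GR _ setT f by exact: mE.
pose mW1 := isMeasurableFun.Build _ _ T GR _ mW'.
pose W1 : {mfun T >-> GR} := HB.pack (W 1 : T -> GR) mW1.
rewrite -[RHS]/(fine ((Num.sqrt (1 + t))^-1)%:E) -normal_laplace_sqr//; congr fine.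
transitivity (\int[distribution Q W1]_y f y)%E.
  have := @ge0_integral_pushforward _ _ T GR R (W 1) mW' Q setT f measurableT mf.
  rewrite preimage_setT /distribution => ->//.
  by move=> x _; rewrite lee_fin expR_ge0.
by apply: eq_measure_integral => A mA _; exact: fBm_law1.
Qed.

End LimitProcess.

(** * The estimator as a banded quadratic form *)

Section SampleVariance.
Context {R : realType} {d : measure_display} {T : measurableType d}.
Variables (P : probability T R) (X : nat -> T -> R).

Let Y (i : nat) w := X i.+1 w - mean P X.

Lemma xbar_centred n w : (0 < n)%N ->
  xbar X n w = mean P X + n%:R^-1 * \sum_(i < n) Y i w.
Proof.
move=> n0; rewrite /xbar big_add1 /= big_mkord sumrB sumr_const card_ord mulrBr.
by rewrite -[X in _ - _ * X]mulr_natl mulKf ?pnatr_eq0 ?gtn_eqF// addrC subrK.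
Qed.

(** With $m=q+1$ the Bartlett weight is $(m-j)/m$, so the identity is exact. [Y] starts at 0 where
    the sample starts at 1. *)
Lemma s2_quad (q : nat -> nat) n w : (0 < n)%N -> let m := (q n).+1 in
  s2 X q n w = quad (fun i w => Y i w - n%:R^-1 * \sum_(i < n) Y i w) n (@bw R m) w
     / (n%:R * m%:R).
Proof.
move=> n0 m; rewrite /quad.
pose z (i : nat) w := Y i w - n%:R^-1 * \sum_(i < n) Y i w.
have n0' : n%:R != 0 :> R by rewrite pnatr_eq0 gtn_eqF.
have m0' : m%:R != 0 :> R by rewrite pnatr_eq0.
have zE i : X i.+1 w - xbar X n w = z i w.
  by rewrite xbar_centred// /z /Y; ring.
have gE j : gamma_hat X n j w = n%:R^-1 * \sum_(i < n - j) z i w * z (i + j)%N w.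
  rewrite /gamma_hat big_add1 /= big_mkord; congr (_ * _).
  by apply: eq_bigr => i _; rewrite addSn !zE.
rewrite (@distn_sum R (fun h => (m - h)%N%:R) (z ^~ w) n m)//; last first.
  by move=> j mj; rewrite (_ : (m - j = 0)%N)//; lia.
rewrite /s2 gE subn0 [RHS]mulrDl; congr (_ + _).
  under eq_bigr do rewrite addn0.
  by rewrite mulrC; field; rewrite n0' m0'.
rewrite -mulrA; congr (_ * _); rewrite mulr_suml; apply: eq_big_nat => j /andP[_ jm].
rewrite gE /bartlett -/m natrB; last by rewrite ltnW.
by field; rewrite n0' m0'.
Qed.

End SampleVariance.

(** * From convergence in law to convergence of second moments *)

Section SecondMoment.
Context {R : realType}.

(* Bounded, tends to u^2 as b -> 0, and has an explicit Gaussian expectation. *)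
Definition soft_sqr (b u : R) : R := 2 / b * (1 - expR (- (b * u ^+ 2 / 2))).

Lemma soft_sqr_continuous b : continuous (soft_sqr b).
Proof.
move=> u; apply: cvgMr; apply: cvgB; first exact: cvg_cst.
apply: continuous_comp; last exact: continuous_expR.
by apply: cvgN; apply: cvgMl; apply: cvgMr; exact: exprn_continuous.
Qed.

Lemma soft_sqr_bounded b u : 0 < b -> `|soft_sqr b u| <= 2 / b.
Proof.
move=> b0; rewrite /soft_sqr normrM ger0_norm ?divr_ge0// ?(ltW b0)//.
rewrite ler_piMr ?divr_ge0// ?(ltW b0)//.
have h : expR (- (b * u ^+ 2 / 2)) <= 1.
  by rewrite -expR0 ler_expR oppr_le0 divr_ge0// mulr_ge0 ?sqr_ge0// ltW.
by rewrite ger0_norm ?subr_ge0// lerBlDr lerDl expR_ge0.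
Qed.

(** With $s=bu^2/2$ the difference is $\frac2b(e^{-s}-1+s)$, and $0\le e^{-s}-1+s\le s^2$ for
    $s\ge0$. *)
Lemma soft_sqr_bounds b u : 0 < b -> 0 <= u ^+ 2 - soft_sqr b u <= b / 2 * u ^+ 4.
Proof.
move=> b0; set s := b * u ^+ 2 / 2.
have s0 : 0 <= s by rewrite divr_ge0// mulr_ge0 ?sqr_ge0// ltW.
have e1 : 1 - s <= expR (- s) by exact: expR_ge1Dx.
have e2 : expR (- s) <= 1 - s + s ^+ 2.
  rewrite expRN -[leLHS]mul1r ler_pdivrMr ?expR_gt0//.
  have h : 1 + s <= expR s by exact: expR_ge1Dx.
  have p : 0 <= 1 - s + s ^+ 2 by nra.
  apply: le_trans (ler_wpM2l p h); have : 0 <= s ^+ 3 by rewrite exprn_ge0.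
  nra.
have -> : u ^+ 2 - soft_sqr b u = 2 / b * (s - (1 - expR (- s))).
  by rewrite /soft_sqr -/s {2}/s; field; rewrite gt_eqF.
have -> : b / 2 * u ^+ 4 = 2 / b * s ^+ 2 by rewrite /s; field; rewrite gt_eqF.
have b2 : 0 <= 2 / b by rewrite divr_ge0// ltW.
by apply/andP; split; [rewrite mulr_ge0//|rewrite ler_wpM2l//]; lra.
Qed.

(** With $v=\sqrt{1+bc^2}$ this is a polynomial inequality in $v-1\ge0$. It says that the limiting
    value of the softened second moment is within $O(b)$ of $c^2$. *)
Lemma laplace_second_order (b c : R) : 0 < b ->
  `|2 / b * (1 - (Num.sqrt (1 + b * c ^+ 2))^-1) - c ^+ 2| <= 2 * b * c ^+ 4.
Proof.
move=> b0; set y := b * c ^+ 2.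
have y0 : 0 <= y by rewrite mulr_ge0 ?sqr_ge0// ltW.
set v := Num.sqrt (1 + y).
have v2 : v ^+ 2 = 1 + y by rewrite sqr_sqrtr// addr_ge0.
have v0 : 0 <= v by exact: sqrtr_ge0.
have v1 : 1 <= v.
  by rewrite -[leLHS]sqrtr1 ler_sqrt ?lerDl// addr_ge0.
have yE : y = v ^+ 2 - 1 by rewrite v2; ring.
have vgt0 : 0 < v by exact: lt_le_trans v1.
have -> : 2 / b * (1 - v^-1) - c ^+ 2 = (b * v)^-1 * (2 * (v - 1) - y * v).
  by rewrite /y; field; rewrite !gt_eqF.
have -> : 2 * b * c ^+ 4 = (b * v)^-1 * (2 * y ^+ 2 * v).
  by rewrite /y; field; rewrite !gt_eqF.
have bv : 0 < (b * v)^-1 by rewrite invr_gt0 mulr_gt0.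
rewrite normrM (gtr0_norm bv) ler_wpM2l ?(ltW bv)//.
move: v1; rewrite -subr_ge0 yE; set e := v - 1 => e0.
have -> : v = 1 + e by rewrite /e; ring.
have e2 := sqr_ge0 e; have e3 : 0 <= e ^+ 3 by rewrite exprn_ge0.
have e4 : 0 <= e ^+ 4 by rewrite exprn_ge0.
have e5 : 0 <= e ^+ 5 by rewrite exprn_ge0.
rewrite ler_norml; apply/andP; split; nra.
Qed.

Context {d d' : measure_display} {T : measurableType d} {T' : measurableType d'}.
Variables (P : probability T R) (Q : probability T' R) (H : R) (W : R -> T' -> R).
Hypotheses (H0 : 0 < H) (WfBm : is_fBm Q H W).

(** The fourth-moment bound plays the part of uniform integrability: replacing $x_n^2$ by
    [soft_sqr b] costs at most $bK/2$ for every large $n$. *)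
Lemma second_moment_cvg (x : nat -> T -> R) (c K : R) (N : nat) :
  (forall n, L4 P (x n)) ->
  (forall n, (N <= n)%N -> Ex P (fun w => x n w ^+ 4) <= K) ->
  (forall f : R -> R, continuous f -> (exists M : R, forall u, `|f u| <= M) ->
    Ex P (fun w => f (x n w)) @[n --> \oo] --> Ex Q (fun w => f (c * W 1 w))) ->
  Ex P (fun w => x n w ^+ 2) @[n --> \oo] --> c ^+ 2.
Proof.
move=> xL4 xK xf; apply/cvgrPdist_le => e e0.
have K0 : 0 <= K.
  by apply: le_trans (xK N (leqnn N)); apply: Ex_ge0 => w; rewrite exprn_even_ge0.
have c4 : 0 <= c ^+ 4 by rewrite exprn_even_ge0.
(* [b * D] covers the costs $bK/2$ and $2bc^4$ of the two replacements; the 1 keeps [D] positive.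
   The other half of [e] goes to the weak convergence. *)
pose D := K / 2 + 2 * c ^+ 4 + 1.
have D0 : 0 < D by rewrite ltr_wpDl// addr_ge0 ?divr_ge0// mulr_ge0.
pose b : R := e / 2 / D; have b0 : 0 < b by rewrite !divr_gt0.
have bD : b * D = e / 2 by rewrite divfK ?gt_eqF.
have bnd : exists M : R, forall u, `|soft_sqr b u| <= M.
  by exists (2 / b) => u; exact: soft_sqr_bounded.
have /cvgrPdist_le/(_ (e / 2)) := xf _ (@soft_sqr_continuous b) bnd.
move=> /(_ (divr_gt0 e0 (ltr0Sn R 1))) [N1 _ hN1].
exists (maxn N N1) => // n /=; rewrite geq_max => /andP[Nn N1n].
have := hN1 n N1n => /=; set u := Ex Q _; set v := Ex P _ => uv.
have uE : u = 2 / b * (1 - (Num.sqrt (1 + b * c ^+ 2))^-1).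
  have bc0 : 0 <= b * c ^+ 2 by rewrite mulr_ge0 ?sqr_ge0// ltW.
  have [mW _] := WfBm.
  have iE : intg Q (fun w => expR (- (b * c ^+ 2 * W 1 w ^+ 2 / 2))).
    apply: (@intg_bounded _ _ _ _ _ 1).
      apply: measurableT_comp => //; apply: measurableT_comp => //.
      by apply: measurable_funM => //; apply: measurable_funM => //; exact: measurable_funX.
    move=> w; rewrite ger0_norm ?expR_ge0// -expR0 ler_expR oppr_le0 divr_ge0//.
    by rewrite mulr_ge0// sqr_ge0.
  have i1 := intg_cst Q 1.
  rewrite -(fBm_laplace_sqr1 H0 WfBm bc0) -[X in X - Ex Q _](Ex_cst Q 1) -ExB//.
  rewrite -ExZ; last exact: intgB.
  by apply: eq_Ex => w; rewrite /soft_sqr exprMn mulrA.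
have i2 : intg P (fun w => x n w ^+ 2).
  by under eq_fun do rewrite expr2; exact: L4_intg2.
have [mx i4] := xL4 n.
have ig : intg P (fun w => soft_sqr b (x n w)).
  apply: (@intg_bounded _ _ _ _ _ (2 / b)); last by move=> w; exact: soft_sqr_bounded.
  apply: measurableT_comp mx; apply: continuous_measurable_fun; exact: soft_sqr_continuous.
have iB := intgB i2 ig.
have hb : 0 <= Ex P (fun w => x n w ^+ 2) - v <= b / 2 * K.
  rewrite /v -ExB//; apply/andP; split.
    by apply: Ex_ge0 => w; case/andP: (soft_sqr_bounds (x n w) b0).
  apply: (@le_trans _ _ (Ex P (fun w => b / 2 * x n w ^+ 4))).
    by apply: le_Ex => //; [exact: intgZ|move=> w; case/andP: (soft_sqr_bounds (x n w) b0)].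
  by rewrite ExZ//; apply: ler_wpM2l (xK n Nn); rewrite divr_ge0// ltW.
have := laplace_second_order c b0; rewrite -uE => hc.
move: hb => /andP[hb1 hb2].
move: uv hc bD; rewrite /D !ler_norml => /andP[u1 u2] /andP[u3 u4] bD.
by apply/andP; split; nra.
Qed.

End SecondMoment.

(** * Continuity and measurability of the bridge functional *)

Section BridgeFunctional.
Context {R : realType}.

(** Either both sets are bounded above or neither is; in the latter case both suprema are 0 by
    convention. *)
Lemma sup_close (A B : set R) (e : R) : 0 <= e -> A !=set0 -> B !=set0 ->
  (forall a, A a -> exists2 b, B b & a <= b + e) ->
  (forall b, B b -> exists2 a, A a & b <= a + e) ->
  `|sup A - sup B| <= e.
Proof.
have half (C D : set R) : C !=set0 -> has_ubound D ->
    (forall a, C a -> exists2 b, D b & a <= b + e) -> sup C <= sup D + e.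
  move=> C0 uD CD; apply: ge_sup => // a /CD[b Db ab].
  by apply: (le_trans ab); rewrite lerD2r; apply: ub_le_sup.
have ub (C D : set R) : has_ubound D ->
    (forall a, C a -> exists2 b, D b & a <= b + e) -> has_ubound C.
  move=> [M MD] CD; exists (M + e) => a /CD[b Db ab].
  by apply: (le_trans ab); rewrite lerD2r; exact: MD.
move=> e0 A0 B0 AB BA.
have [uA|uA] := pselect (has_ubound A).
  have uB := ub _ _ uA BA.
  have := half _ _ A0 uB AB; have := half _ _ B0 uA BA.
  by move=> h1 h2; rewrite ler_norml; apply/andP; split; lra.
have uB : ~ has_ubound B by move=> uB; apply: uA; exact: ub uB AB.
by rewrite !sup_out ?subrr ?normr0//; case.
Qed.

Definition bridge_sup (x : R -> R) : R := sup [set `|x t - t * x 1| | t in `[0, 1]].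

Lemma bridge_set_neq0 (x : R -> R) : [set `|x t - t * x 1| | t in `[0, 1]] !=set0.
Proof. by exists `|x 0 - 0 * x 1|; exists 0 => //=; rewrite in_itv/= lexx ler01. Qed.

Lemma bridge_sup_scale c (x : R -> R) : 0 < c ->
  (exists B, forall t, 0 <= t <= 1 -> `|x t| <= B) ->
  bridge_sup (fun t => c * x t) = c * bridge_sup x.
Proof.
move=> c0 [B hB]; rewrite /bridge_sup.
have hx : has_sup [set `|x t - t * x 1| | t in `[0, 1]].
  split; first exact: bridge_set_neq0.
  exists (B + B) => _ [t /= t01 <-]; rewrite in_itv/= in t01.
  rewrite (le_trans (ler_normB _ _))// lerD//; first exact: hB.
  have /andP[t0 t1] := t01; rewrite normrM ger0_norm// (le_trans _ (hB 1 _)) ?ler01 ?lexx//.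
  by rewrite ler_piMl.
have scE t : `|c * x t - t * (c * x 1)| = c * `|x t - t * x 1|.
  by rewrite -[in RHS](gtr0_norm c0) -normrM mulrBr mulrCA.
have ub : sup [set `|c * x t - t * (c * x 1)| | t in `[0, 1]]
    <= c * sup [set `|x t - t * x 1| | t in `[0, 1]].
  apply: ge_sup; first exact: (bridge_set_neq0 (fun t => c * x t)).
  move=> _ [t t01 <-]; rewrite scE ler_pM2l//; apply: ub_le_sup; first by case: hx.
  by exists t.
apply/eqP; rewrite eq_le ub /= mulrC -ler_pdivlMr//; apply: ge_sup.
  exact: bridge_set_neq0.
move=> _ [t t01 <-]; rewrite ler_pdivlMr// mulrC -scE; apply: ub_le_sup; last by exists t.
have [_ [M hM]] := hx; exists (c * M) => _ [s s01 <-].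
by rewrite scE ler_pM2l// hM//; exists s.
Qed.

Lemma time_change_onto (lam : R -> R) s : time_change lam -> 0 <= s <= 1 ->
  exists2 t, 0 <= t <= 1 & lam t = s.
Proof.
move=> [l0 [l1 [lc _]]] s01.
have := @IVT R lam 0 1 s ler01 lc.
by rewrite l0 l1 minElt maxElt ltr01 => /(_ s01)[t t01 <-]; exists t.
Qed.

Lemma time_change01 (lam : R -> R) t : time_change lam -> 0 <= t <= 1 -> 0 <= lam t <= 1.
Proof.
move=> [l0 [l1 [_ linc]]] /andP[t0 t1]; apply/andP; split.
  move: t0; rewrite le_eqVlt => /predU1P[<-|t0]; first by rewrite l0.
  by rewrite -l0 ltW// linc.
move: t1; rewrite le_eqVlt => /predU1P[->|t1]; first by rewrite l1.
by rewrite -l1 ltW// linc.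
Qed.

(** The bridge of $x$ at $t$ is compared with that of $y$ at $\lambda(t)$; since $\lambda(1)=1$ the
    difference splits into errors $e$, $e|x(1)|$ and $e$. Surjectivity of $\lambda$ gives the
    converse comparison. *)
Lemma bridge_sup_close (x y : R -> R) e : 0 <= e -> skorokhod_close x y e ->
  `|bridge_sup x - bridge_sup y| <= e * (2 + `|x 1|).
Proof.
move=> e0 [lam [tc h]].
have close t : 0 <= t <= 1 ->
    `|(x t - t * x 1) - (y (lam t) - lam t * y 1)| <= e * (2 + `|x 1|).
  move=> t01; have [h1 h2] := h _ t01.
  have /andP[l0 l1] := time_change01 tc t01.
  have := h 1; rewrite ler01 lexx => /(_ isT) [_]; have [_ [-> _]] := tc => h3.
  have -> : x t - t * x 1 - (y (lam t) - lam t * y 1) =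
     (x t - y (lam t)) + (lam t - t) * x 1 - lam t * (x 1 - y 1) by ring.
  rewrite (_ : e * _ = e + e * `|x 1| + e); last by ring.
  rewrite (le_trans (ler_normB _ _))// lerD//; last first.
    by rewrite normrM ger0_norm// (le_trans _ h3)// ler_piMl.
  by rewrite (le_trans (ler_normD _ _))// lerD// normrM ler_wpM2r.
apply: sup_close; rewrite ?mulr_ge0 ?addr_ge0//; try exact: bridge_set_neq0.
- move=> _ [t /= + <-]; rewrite in_itv/= => t01.
  exists `|y (lam t) - lam t * y 1|.
    by exists (lam t) => //=; rewrite in_itv/= time_change01.
  by rewrite -lerBlDl (le_trans (lerB_dist _ _))// close.
- move=> _ [s /= + <-]; rewrite in_itv/= => s01.
  have [t t01 <-] := time_change_onto tc s01.
  exists `|x t - t * x 1|; first by exists t => //=; rewrite in_itv/=.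
  by rewrite -lerBlDl (le_trans (lerB_dist _ _))// distrC close.
Qed.

Lemma D_test_bridge (f : R -> R) (c : R) : continuous f ->
  (exists M, forall u, `|f u| <= M) -> D_test (fun x => f (bridge_sup x / c)).
Proof.
move=> fc [M fM]; split; first by exists M.
move=> x _ e e0.
have := fc (bridge_sup x / c) => /cvgrPdist_lt/(_ e e0) /nbhs_ballP[del /= del0 hdel].
(* The modulus from [bridge_sup_close] over $|c|$, plus 1 to be positive; it depends on [x], as
   pointwise continuity allows. *)
pose K : R := (2 + `|x 1|) * `|c^-1| + 1.
have K0 : 0 < K by rewrite ltr_wpDl// mulr_ge0// addr_ge0.
exists (del / 2 / K); first by rewrite !divr_gt0.
move=> y _ xy; apply: hdel; rewrite /ball/= -mulrBl normrM.
have d0 : 0 <= del / 2 / K by rewrite ltW// !divr_gt0.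
apply: (@le_lt_trans _ _ (del / 2 / K * K)); last first.
  by rewrite divfK ?gt_eqF// ltr_pdivrMr// ltr_pMr// ltr1n.
apply: (@le_trans _ _ (del / 2 / K * ((2 + `|x 1|) * `|c^-1|))); last first.
  by rewrite ler_wpM2l// /K lerDl.
by rewrite mulrA ler_wpM2r// bridge_sup_close.
Qed.

(** Time changes fix 1, so evaluation there is Skorokhod continuous. *)
Lemma D_test_end (f : R -> R) : continuous f ->
  (exists M, forall u, `|f u| <= M) -> D_test (fun x => f (x 1)).
Proof.
move=> fc [M fM]; split; first by exists M.
move=> x _ e e0.
have := fc (x 1) => /cvgrPdist_lt/(_ e e0) /nbhs_ballP[del /= del0 hdel].
exists (del / 2); first by rewrite divr_gt0.
move=> y _ [lam [[_ [l1 _]] h]]; apply: hdel; rewrite /ball/=.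
have := h 1; rewrite ler01 lexx l1 => /(_ isT)[_ h1].
by apply: le_lt_trans h1 _; rewrite ltr_pdivrMr// ltr_pMr// ltr1n.
Qed.

(** An enumeration of the rationals of $[0,1]$, pairs being coded by [pickle]; the cap and the
    default value 1 keep it inside the interval. *)
Definition grid (k : nat) : R :=
  if unpickle k is Some (i, j) then Num.min 1 (i%:R / j.+1%:R) else 1.

Lemma grid01 k : 0 <= grid k <= 1.
Proof.
rewrite /grid; case: unpickle => [[i j]|]; last by rewrite ler01 lexx.
by rewrite le_min ler01 divr_ge0//= ge_min lexx.
Qed.

Lemma grid_dense t e : 0 <= t <= 1 -> 0 < e -> exists k, t <= grid k <= t + e.
Proof.
move=> /andP[t0 t1] e0.
pose j := Num.truncn e^-1.
have je : (j.+1%:R)^-1 <= e.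
  rewrite -[leRHS]invrK lef_pV2 ?posrE ?invr_gt0// ltW//.
  by rewrite truncnS_gt.
have j0 : 0 < j.+1%:R :> R by [].
pose i := (Num.truncn (t * j.+1%:R)).+1.
exists (pickle (i, j)); rewrite /grid pickleK le_min t1 ge_min /=.
rewrite ler_pdivlMr// ltW ?truncnS_gt//=; apply/orP; right.
rewrite ler_pdivrMr// mulrDl /i -natr1 lerD//.
  by rewrite truncn_le mulr_ge0.
by rewrite -ler_pdivrMr// mul1r.
Qed.

(** Right continuity lets grid points just above $t$ replace $t$, so the supremum is countable. At
    $t=1$ nothing lies to the right, but 1 is itself a grid point. *)
Lemma measurable_bridge_sup {d : measure_display} {T : measurableType d} (Z : R -> T -> R) :
  (forall t, measurable_fun setT (Z t)) ->
  (forall w, exists B, forall t, 0 <= t <= 1 -> `|Z t w| <= B) ->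
  (forall w t e, 0 <= t < 1 -> 0 < e -> exists2 del, 0 < del &
     forall s, t <= s <= t + del -> s <= 1 -> `|Z s w - Z t w| <= e) ->
  measurable_fun setT (fun w => bridge_sup (Z ^~ w)).
Proof.
move=> mZ bZ rZ.
pose h k w := `|Z (grid k) w - grid k * Z 1 w|.
have hb w : has_ubound (range (h ^~ w)).
  have [B hB] := bZ w; exists (B + B) => _ [k _ <-].
  have k01 := grid01 k; have /andP[k0 k1] := k01.
  rewrite (le_trans (ler_normB _ _))// lerD//; first exact: hB.
  rewrite normrM ger0_norm// (le_trans _ (hB 1 _)) ?ler01 ?lexx//.
  by rewrite ler_piMl.
rewrite [X in measurable_fun _ X](_ : _ = fun w => sups (h ^~ w) 0%N).
  apply: measurable_fun_sups => // m.
  by apply: measurableT_comp => //; apply: measurable_funB => //; exact: measurable_funM.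
apply/funext => w; apply/eqP; rewrite -subr_eq0 -normr_le0; apply/ler_addgt0Pr => e e0; rewrite add0r.
rewrite /sups /bridge_sup; apply: sup_close; rewrite ?(ltW e0)//.
- exact: bridge_set_neq0.
- by exists (h 0%N w); exists 0%N.
- move=> _ [t /= + <-]; rewrite in_itv/= => /andP[t0]; rewrite le_eqVlt => /predU1P[->|t1].
    have [|k /andP[k1 _]] := @grid_dense 1 1 _ ltr01; first by rewrite ler01 lexx.
    have kE : grid k = 1 by apply/eqP; rewrite eq_le k1; case/andP: (grid01 k) => _ ->.
    by exists (h k w); [exists k|rewrite /h kE lerDl ltW].
  have [|del del0 hdel] := rZ w t (e / 2) _ (divr_gt0 e0 (ltr0Sn R 1)); first by rewrite t0.
  pose D : R := `|Z 1 w| + 1; have D0 : 0 < D by rewrite ltr_wpDl.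
  pose r := Num.min del (e / 2 / D).
  have r0 : 0 < r by rewrite lt_min del0 !divr_gt0.
  have [|k /andP[tk kt]] := @grid_dense t r _ r0; first by rewrite t0 ltW.
  exists (h k w); first by exists k.
  have k1 : grid k <= 1 by case/andP: (grid01 k).
  have hk : `|Z (grid k) w - Z t w| <= e / 2.
    apply: hdel => //; rewrite tk (le_trans kt)// lerD2l ge_min lexx//.
  have hk2 : (grid k - t) * `|Z 1 w| <= e / 2.
    apply: (@le_trans _ _ (e / 2 / D * D)); last by rewrite divfK ?gt_eqF.
    apply: ler_pM => //; first by rewrite subr_ge0.
      by rewrite lerBlDl (le_trans kt)// lerD2l ge_min lexx orbT.
    by rewrite /D lerDl.
  rewrite -lerBlDl /h (le_trans (lerB_dist _ _))//.
  rewrite [X in `|X|](_ : _ = - (Z (grid k) w - Z t w) + (grid k - t) * Z 1 w); last by ring.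
  rewrite (le_trans (ler_normD _ _))// normrN normrM ger0_norm ?subr_ge0//.
  by rewrite [e]splitr lerD.
- move=> _ [k _ <-]; exists (h k w); last by rewrite lerDl ltW.
  by exists (grid k) => //=; rewrite in_itv/= grid01.
Qed.

End BridgeFunctional.

(** * Moduli of continuity and smooth tail cut-offs *)

Section Slutsky.
Context {R : realType}.

(** Compactness of $[-K,K]$ is applied to a predicate quantified over all [y], so that only one of
    the two points has to be bounded. *)
Lemma continuous_modulus (g : R -> R) (K e : R) : continuous g -> 0 < e ->
  exists2 del, 0 < del & forall x y, `|x| <= K -> `|x - y| < del -> `|g x - g y| <= e.
Proof.
move=> gc e0.
have /compact_near_coveringP/(_ R (0^'+) (fun del x => forall y, `|x - y| < del -> `|g x - g y| <= e)) :=
  @segment_compact R (- K) K.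
case.
  move=> x _; have /cvgrPdist_lt/(_ (e / 2)) := gc x.
  move=> /(_ (divr_gt0 e0 (ltr0Sn R 1)))/nbhs_ballP[d /= d0 hd].
  have d20 : 0 < d / 2 by rewrite divr_gt0.
  exists (ball x (d / 2), [set u | u < d / 2]).
    split => /=; first exact: nbhsx_ballx.
    exact: nbhs_right_lt.
  move=> [x' del] /= [xx' deld] y x'y.
  have h1 : `|g x - g x'| < e / 2.
    by apply: hd; apply: (lt_le_trans xx'); rewrite ler_pdivrMr// ler_peMr ?ler1n// ltW.
  have h2 : `|g x - g y| < e / 2.
    apply: hd; rewrite /ball/= -(subrKA x') (le_lt_trans (ler_normD _ _))//.
    by rewrite [d]splitr ltrD// (lt_trans x'y).
  rewrite -(subrKA (g x)) (le_trans (ler_normD _ _))// [e]splitr lerD//.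
    by rewrite distrC ltW.
  exact: ltW.
move=> d /= d0 hd; exists (d / 2); first by rewrite divr_gt0.
move=> x y xK xy; apply: (hd (d / 2)) => //=.
- by rewrite /ball/= sub0r normrN gtr0_norm ?divr_gt0// ltr_pdivrMr// ltr_pMr// ltr1n.
- by rewrite divr_gt0.
- by rewrite in_itv/= -ler_norml.
Qed.

(** A continuous stand-in for the indicator of $|x|>k$, equal to 1 from $k+1$ on; weak convergence
    can be tested on it, which transfers tightness from the limit. *)
Definition tail_cut (k : nat) (x : R) : R := Num.min 1 (Num.max 0 (`|x| - k%:R)).

Lemma tail_cut_continuous k : continuous (tail_cut k).
Proof.
move=> x; apply: (@continuous_min _ _ (fun=> 1) (fun x => Num.max 0 (`|x| - k%:R))).
  exact: cvg_cst.
apply: (@continuous_max _ _ (fun=> 0) (fun x => `|x| - k%:R)); first exact: cvg_cst.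
by apply: cvgB; [exact: norm_continuous|exact: cvg_cst].
Qed.

Lemma tail_cut01 k x : 0 <= tail_cut k x <= 1.
Proof. by rewrite /tail_cut le_min ler01 le_max lexx /= ge_min lexx. Qed.

Lemma tail_cut_bounded k x : `|tail_cut k x| <= 1.
Proof. by have /andP[h1 h2] := tail_cut01 k x; rewrite ger0_norm. Qed.

Lemma tail_cut1 k x : k.+1%:R <= `|x| -> tail_cut k x = 1.
Proof.
move=> h; rewrite /tail_cut; apply/min_idPl; rewrite le_max; apply/orP; right.
by rewrite lerBrDr nat1r.
Qed.

Lemma tail_cut0 k x : `|x| <= k%:R -> tail_cut k x = 0.
Proof.
move=> h; rewrite /tail_cut (_ : Num.max 0 _ = 0); first by apply/min_idPr.
by apply/max_idPl; rewrite subr_le0.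
Qed.

Context {d : measure_display} {T : measurableType d}.
Variable P : probability T R.

Lemma intg_comp_bounded (f : R -> R) M (Z : T -> R) : continuous f -> (forall u, `|f u| <= M) ->
  measurable_fun setT Z -> intg P (fun w => f (Z w)).
Proof.
move=> fc fM mZ; apply: (@intg_bounded _ _ _ _ _ M) => //.
by apply: measurableT_comp mZ; exact: continuous_measurable_fun.
Qed.

Lemma tail_cut_cvg0 (L : T -> R) : measurable_fun setT L ->
  Ex P (fun w => tail_cut k (L w)) @[k --> \oo] --> (0 : R).
Proof.
move=> mL.
have := @dominated_cvg _ _ _ P setT measurableT (fun k w => (tail_cut k (L w))%:E) (fun=> 0%E) (fun=> 1%E).
rewrite integral0 => h; apply: (fine_cvg (h _ _ _ _ _)) => //.
- move=> k; apply/measurable_EFinP; apply: measurableT_comp mL.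
  by apply: continuous_measurable_fun; exact: tail_cut_continuous.
- move=> w _; apply: cvg_near_cst; exists (Num.truncn `|L w|).+1 => // k /= Lk.
  by rewrite tail_cut0// ltW// (lt_le_trans (truncnS_gt _))// ler_nat.
- exact: intg_cst.
- by move=> k w _; rewrite lee_fin tail_cut_bounded.
Qed.

End Slutsky.

(** * A Slutsky lemma with truncation *)

Section SlutskyConvergence.
Context {R : realType} {d d' : measure_display} {T : measurableType d} {T' : measurableType d'}.
Variables (P : probability T R) (Q : probability T' R).

(* Closeness of Y n and A n is only required where A n is bounded; the tightness
   of the limit takes care of the rest. *)
Lemma conv_dist_close (A Y : nat -> T -> R) (L : T' -> R) (N : nat) :
  (forall n, measurable_fun setT (A n)) -> (forall n, measurable_fun setT (Y n)) ->
  measurable_fun setT L ->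
  (forall f : R -> R, continuous f -> (exists M, forall u, `|f u| <= M) ->
    Ex P (fun w => f (A n w)) @[n --> \oo] --> Ex Q (fun w => f (L w))) ->
  (forall K del : R, 0 < K -> 0 < del -> exists r : nat -> T -> R,
    [/\ forall n, intg P (r n), forall n w, 0 <= r n w,
        Ex P (r n) @[n --> \oo] --> (0 : R) &
        forall n w, (N <= n)%N -> `|A n w| <= K -> del <= `|Y n w - A n w| -> 1 <= r n w]) ->
  conv_dist P Q Y L.
Proof.
move=> mA mY mL AL close g gc [M0 gM0].
pose M := `|M0| + 1; have M_gt0 : 0 < M by rewrite ltr_wpDl.
have gM u : `|g u| <= M by rewrite (le_trans (gM0 u))// /M (le_trans (ler_norm _))// lerDl.
clearbody M.
have iL f B (fc : continuous f) (fB : forall u, `|f u| <= B) :=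
  intg_comp_bounded Q fc fB mL.
have iA n f B (fc : continuous f) (fB : forall u, `|f u| <= B) :=
  intg_comp_bounded P fc fB (mA n).
have iY n := intg_comp_bounded P gc gM (mY n).
rewrite ExE; last exact: iL gM.
rewrite (_ : (fun n => _) = EFin \o (fun n => Ex P (fun w => g (Y n w)))); last first.
  by apply/funext => n /=; rewrite ExE.
apply: cvg_EFin; first by near=> n.
apply/cvgrPdist_le => e e0.
(* Of eight parts of [e], six pay for $2M\cdot3e_1$ (tail of [A n] at most $2e_1$, [r n] at most
   $e_1$), one for the modulus of [g] and one for the convergence of [A n]. *)
pose e1 := e / 8 / M.
have e10 : 0 < e1 by rewrite !divr_gt0.
have e1M : e1 * M = e / 8 by rewrite divfK ?gt_eqF.
clearbody e1.
have e80 : 0 < e / 8 by rewrite divr_gt0.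
have /cvgrPdist_lt/(_ _ e10)[k _ /(_ k (leqnn k))] := tail_cut_cvg0 Q mL.
rewrite /= sub0r normrN => hk.
(* The truncation level is $k+1$ because [tail_cut k] reaches 1 only there. *)
have K0 : 0 < k.+1%:R :> R by [].
have [del del0 hdel] := continuous_modulus k.+1%:R gc e80.
have [r [ir r0 rcvg hr]] := close k.+1%:R del K0 del0.
have tb : exists M, forall u, `|tail_cut k u| <= M :> R.
  by exists 1 => u; exact: tail_cut_bounded.
have gb : exists M, forall u, `|g u| <= M by exists M.
have /cvgrPdist_lt/(_ _ e10)[N1 _ hN1] := AL _ (@tail_cut_continuous R k) tb.
have /cvgrPdist_lt/(_ _ e80)[N2 _ hN2] := AL _ gc gb.
have /cvgrPdist_lt/(_ _ e10)[N3 _ hN3] := rcvg.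
exists (maxn (maxn N N1) (maxn N2 N3)) => // n /=.
rewrite !geq_max => /andP[/andP[Nn N1n] /andP[N2n N3n]].
have {}hN1 := hN1 n N1n; have {}hN2 := hN2 n N2n; have {}hN3 := hN3 n N3n.
rewrite /= in hN1 hN2 hN3; rewrite sub0r normrN in hN3.
have ic : intg P (fun w => tail_cut k (A n w)) by apply: iA; [exact: tail_cut_continuous|exact: tail_cut_bounded].
have ig : intg P (fun w => g (A n w)) by exact: iA gM.
have ip : intg P (fun w => e / 8 + 2 * M * (tail_cut k (A n w) + r n w)).
  by apply: intgD; [exact: intg_cst|apply: intgZ; exact: intgD].
have ii := intgB (iY n) ig.
have : `|Ex P (fun w => g (Y n w)) - Ex P (fun w => g (A n w))| <=
    e / 8 + 2 * M * (Ex P (fun w => tail_cut k (A n w)) + Ex P (r n)).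
  rewrite -ExB// (le_trans (le_norm_Ex ii))//.
  have <- : Ex P (fun w => e / 8 + 2 * M * (tail_cut k (A n w) + r n w)) =
      e / 8 + 2 * M * (Ex P (fun w => tail_cut k (A n w)) + Ex P (r n)).
    have i1 := intgD ic (ir n); have i2 := intgZ (2 * M) i1.
    have i3 := intg_cst P (e / 8).
    by rewrite ExD// Ex_cst ExZ// ExD.
  apply: le_Ex => // [|w]; first exact: intg_norm.
  have /andP[c0 c1] := tail_cut01 k (A n w).
  have r0w := r0 n w.
  have gYA : `|g (Y n w) - g (A n w)| <= 2 * M.
    by rewrite (le_trans (ler_normB _ _))// mulr_natl mulr2n lerD.
  have [AK|AK] := leP `|A n w| k.+1%:R; last first.
    rewrite tail_cut1 ?(ltW AK)//; apply: (le_trans gYA).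
    rewrite mulrDr mulr1 addrCA lerDl addr_ge0 ?(ltW e80)//.
    by rewrite !mulr_ge0// ltW.
  have [far|near_] := leP del `|Y n w - A n w|.
    have r1 := hr n w Nn AK far.
    apply: (le_trans gYA); apply: (@le_trans _ _ (2 * M * (tail_cut k (A n w) + r n w))).
      by rewrite ler_peMr ?mulr_ge0 ?(ltW M_gt0)// (le_trans r1)// lerDr.
    by rewrite lerDr ltW.
  apply: (@le_trans _ _ (e / 8)).
    by rewrite distrC; apply: hdel => //; rewrite distrC.
  by rewrite lerDl mulr_ge0 ?addr_ge0// mulr_ge0// ltW.
set eY := Ex P (fun w => g (Y n w)); set eA := Ex P (fun w => g (A n w)) in hN2 *.
set eT := Ex P _ in hN1 *; set eR := Ex P (r n) in hN3 *.
set eTL := Ex Q _ in hk hN1; set eL := Ex Q _ in hN2 *.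
move=> h.
have eT2 : eT <= 2 * e1.
  move: hk hN1; rewrite !ltr_norml => /andP[_ h1] /andP[h2 h3]; lra.
have eR1 : eR <= e1 by rewrite ltW// (le_lt_trans (ler_norm _) hN3).
have h8 : 2 * M * (eT + eR) <= 6 * (e / 8).
  apply: (@le_trans _ _ (2 * M * (3 * e1))).
    by rewrite ler_wpM2l ?mulr_ge0 ?(ltW M_gt0)//; lra.
  by rewrite -e1M le_eqVlt; apply/orP; left; apply/eqP; ring.
rewrite -(subrKA eA) (le_trans (ler_normD _ _))//.
by rewrite [X in _ + X]distrC; have := ltW hN2; lra.
Unshelve. all: by end_near.
Qed.

End SlutskyConvergence.

(** * Path properties of the partial sums and of the limit *)

Section Paths.
Context {R : realType} {d : measure_display} {T : measurableType d}.

Lemma le_bigmaxr (I : eqType) (r : seq I) (F : I -> R) i : i \in r ->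
  F i <= \big[Num.max/0]_(j <- r) F j.
Proof.
elim: r => // j r ih; rewrite inE big_cons le_max => /predU1P[->|/ih ->]; first by rewrite lexx.
by rewrite orbT.
Qed.

Definition right_approx (x : R -> R) := forall t e, 0 <= t < 1 -> 0 < e ->
  exists2 del, 0 < del & forall s, t <= s <= t + del -> s <= 1 -> `|x s - x t| <= e.

Lemma continuous01_right_approx (x : R -> R) : {within `[0, 1], continuous x} -> right_approx x.
Proof.
move=> /(continuous_within_itvP _ ltr01)[xc x0 _] t e /andP[t0 t1] e0.
have xt : x s @[s --> t^'+] --> x t.
  move: t0; rewrite le_eqVlt => /predU1P[<-//|t0].
  by apply: cvg_at_right_filter; apply: xc; rewrite in_itv/= t0 t1.
have /cvg_at_right_within/cvgrPdist_le/(_ e e0) := xt.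
move=> [del /= del0 h]; exists (del / 2); first by rewrite divr_gt0.
move=> s /andP[ts sd] _; rewrite distrC; apply: h => //=.
rewrite distrC ger0_norm ?subr_ge0// ltrBlDl (le_lt_trans sd)// ltrD2l.
by rewrite ltr_pdivrMr// ltr_pMr// ltr1n.
Qed.

Lemma continuous01_bounded (x : R -> R) : {within `[0, 1], continuous x} ->
  exists B, forall t, 0 <= t <= 1 -> `|x t| <= B.
Proof.
move=> xc; have [c1 _ h1] := EVT_max ler01 xc; have [c2 _ h2] := EVT_min ler01 xc.
exists (`|x c1| + `|x c2|) => t t01.
have {}h1 := h1 t; have {}h2 := h2 t; rewrite !in_itv/= in h1 h2.
have {}h1 := h1 t01; have {}h2 := h2 t01.
have := ler_norm (x c1); have := ler_norm (- x c2); rewrite normrN => a b.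
have := normr_ge0 (x c1); have := normr_ge0 (x c2) => a0 b0.
by rewrite ler_norml; apply/andP; split; lra.
Qed.

Variables (P : probability T R) (X : nat -> T -> R) (H : R).
Hypothesis Xm : forall j, measurable_fun setT (X j).
Let Y (i : nat) w := X i.+1 w - mean P X.
Let Z j w := X j w - mean P X.

Lemma measurable_sumr I (r : seq I) (f : I -> T -> R) :
  (forall i, measurable_fun setT (f i)) -> measurable_fun setT (fun w => \sum_(i <- r) f i w).
Proof.
move=> mf; elim: r => [|i r ih].
  rewrite [X in measurable_fun _ X](_ : _ = fun=> 0); first exact: measurable_cst.
  by apply/funext => w; rewrite big_nil.
rewrite [X in measurable_fun _ X](_ : _ = fun w => f i w + \sum_(j <- r) f j w).
  exact: measurable_funD.
by apply/funext => w; rewrite big_cons.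
Qed.

Lemma measurable_bigmaxr I (r : seq I) (f : I -> T -> R) :
  (forall i, measurable_fun setT (f i)) ->
  measurable_fun setT (fun w => \big[Num.max/0]_(i <- r) f i w).
Proof.
move=> mf; elim: r => [|i r ih].
  rewrite [X in measurable_fun _ X](_ : _ = fun=> 0); first exact: measurable_cst.
  by apply/funext => w; rewrite big_nil.
rewrite [X in measurable_fun _ X](_ : _ = f i \max (fun w => \big[Num.max/0]_(j <- r) f j w)).
  exact: measurable_maxr.
by apply/funext => w; rewrite big_cons.
Qed.

Lemma measurable_partial_sum n t : measurable_fun setT (partial_sum_process P X H n t).
Proof.
apply: measurable_funM; first exact: measurable_cst.
by apply: measurable_sumr => i; apply: measurable_funB => //; exact: measurable_cst.
Qed.

Lemma partial_sum_process1 n w :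
  partial_sum_process P X H n 1 w = n%:R `^ (- H) * \sum_(i < n) Y i w.
Proof. by rewrite /partial_sum_process mulr1 natrK big_add1 /= big_mkord. Qed.

Lemma truncn_le_n n (t : R) : 0 <= t <= 1 -> (Num.truncn (n%:R * t) <= n)%N.
Proof.
move=> /andP[t0 t1]; rewrite truncn_le_nat (@le_lt_trans _ _ n%:R)// ?ltr_nat//.
by rewrite ler_piMr.
Qed.

Lemma partial_sum_bounded n w :
  exists B, forall t, 0 <= t <= 1 -> `|partial_sum_process P X H n t w| <= B.
Proof.
exists (n%:R `^ (- H) * \sum_(1 <= j < n.+1) `|Z j w|) => t t01.
rewrite /partial_sum_process normrM ger0_norm ?powR_ge0// ler_wpM2l ?powR_ge0//.
rewrite (le_trans (ler_norm_sum _ _ _))//.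
have kn : ((Num.truncn (n%:R * t)).+1 <= n.+1)%N by rewrite ltnS truncn_le_n.
rewrite [leRHS](big_cat_nat (ltn0Sn (Num.truncn (n%:R * t))) kn) /= lerDl.
exact: sumr_ge0.
Qed.

Lemma partial_sum_right_approx n w : right_approx (partial_sum_process P X H n ^~ w).
Proof.
move=> t e /andP[t0 t1] e0.
have [->|n0] := posnP n.
  exists 1 => // s _ _; rewrite /partial_sum_process !mul0r subrr normr0; exact: ltW.
have n0' : 0 < n%:R :> R by rewrite ltr0n.
have nt0 : 0 <= n%:R * t by rewrite mulr_ge0.
have /andP[k1 k2] := truncn_itv nt0.
set k := Num.truncn (n%:R * t) in k1 k2.
have del0 : 0 < k.+1%:R / n%:R - t by rewrite subr_gt0 ltr_pdivlMr// mulrC.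
(* The next jump is at $(k+1)/n$; half the distance stays strictly before it. *)
exists ((k.+1%:R / n%:R - t) / 2); first by rewrite divr_gt0.
move=> s /andP[ts sd] _; rewrite /partial_sum_process (_ : Num.truncn (n%:R * s) = k).
  by rewrite -/k subrr normr0 ltW.
apply: truncn_def; apply/andP; split.
  by rewrite (le_trans k1)// ler_pM2l.
have sk : s < k.+1%:R / n%:R by lra.
by rewrite mulrC -ltr_pdivlMr.
Qed.

Definition max_bridge n (w : T) : R := \big[Num.max/0]_(1 <= k < n.+1)
     `| \sum_(1 <= i < k.+1) X i w - k%:R / n%:R * \sum_(1 <= i < n.+1) X i w |.

Lemma bridge_sum_centred n k w : (0 < n)%N ->
  \sum_(1 <= i < k.+1) X i w - k%:R / n%:R * \sum_(1 <= i < n.+1) X i w =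
  \sum_(1 <= i < k.+1) Z i w - k%:R / n%:R * \sum_(1 <= i < n.+1) Z i w.
Proof.
move=> n0; have n0' : n%:R != 0 :> R by rewrite pnatr_eq0 gtn_eqF.
rewrite /Z !sumrB !sumr_const_nat !subn1 /= -(mulr_natr (mean P X) k) -(mulr_natr (mean P X) n).
by field.
Qed.

(** At $t=k/n$ the bridge is the $k$-th term of the maximum, the mean cancelling. Between grid
    points only the linear part moves, by at most $|S(1)|/n$. *)
Lemma bridge_sup_max_bridge n w : (0 < n)%N ->
  `|bridge_sup (partial_sum_process P X H n ^~ w) - n%:R `^ (- H) * max_bridge n w| <=
  `|partial_sum_process P X H n 1 w| / n%:R.
Proof.
move=> n0; have n0' : 0 < n%:R :> R by rewrite ltr0n.
set S := partial_sum_process P X H n ^~ w; set M := _ * max_bridge n w.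
have p0 : 0 <= n%:R `^ (- H) :> R by exact: powR_ge0.
have M0 : 0 <= max_bridge n w by apply: bigmax_ge_id.
have SE k : `|S (k%:R / n%:R) - k%:R / n%:R * S 1| =
   n%:R `^ (- H) * `| \sum_(1 <= i < k.+1) X i w - k%:R / n%:R * \sum_(1 <= i < n.+1) X i w |.
  rewrite bridge_sum_centred// /S /partial_sum_process mulr1 natrK.
  rewrite [n%:R * _]mulrC divfK ?gt_eqF// natrK mulrCA -mulrBr normrM.
  by rewrite (ger0_norm p0).
have kM k : (k <= n)%N -> `|S (k%:R / n%:R) - k%:R / n%:R * S 1| <= M.
  move=> kn; rewrite SE /M ler_wpM2l//; have [->|k0] := posnP k.
    by rewrite big_geq// mul0r mul0r subrr normr0.
  have kin : k \in index_iota 1 n.+1 by rewrite mem_index_iota k0 ltnS.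
  exact: (le_bigmaxr _ kin).
have tM t : 0 <= t <= 1 -> `|S t - t * S 1| <= M + `|S 1| / n%:R.
  move=> t01; have /andP[t0 t1] := t01; set k := Num.truncn (n%:R * t).
  have /andP[k1 k2] := truncn_itv (mulr_ge0 (ltW n0') t0).
  rewrite -/k in k1 k2.
  have Sk : S t = S (k%:R / n%:R).
    rewrite /S /partial_sum_process [n%:R * (_ / _)]mulrC divfK ?gt_eqF//.
    by rewrite natrK.
  have -> : S t - t * S 1 = (S (k%:R / n%:R) - k%:R / n%:R * S 1) + (k%:R / n%:R - t) * S 1.
    by rewrite Sk; ring.
  rewrite (le_trans (ler_normD _ _))// lerD ?kM ?truncn_le_n//.
  have h1 : t <= k.+1%:R / n%:R by rewrite ler_pdivlMr// mulrC ltW.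
  have h2 : k%:R / n%:R <= t by rewrite ler_pdivrMr// mulrC.
  rewrite -natr1 mulrDl mul1r in h1.
  by rewrite normrM mulrC ler_wpM2l// ler_norml; apply/andP; split; lra.
have e0 : 0 <= `|S 1| / n%:R by rewrite divr_ge0.
have ub : has_ubound [set `|S t - t * S 1| | t in `[0, 1]].
  exists (M + `|S 1| / n%:R) => _ [t /= t01 <-]; apply: tM.
  by move: t01; rewrite in_itv.
rewrite ler_norml; apply/andP; split.
  rewrite lerBrDr -lerBrDl opprK; apply: (@le_trans _ _ (bridge_sup S)); last by rewrite lerDl.
  have [Mz|Mnz] := eqVneq (n%:R `^ (- H) : R) 0.
    rewrite /M Mz mul0r; apply: (@le_trans _ _ `|S 0 - 0 * S 1|) => //.
    by apply: ub_le_sup => //; exists 0 => //=; rewrite in_itv/= lexx ler01.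
  have pp : 0 < n%:R `^ (- H) :> R by rewrite lt_neqAle eq_sym Mnz.
  rewrite /M mulrC -ler_pdivlMr// /max_bridge big_seq; apply: bigmax_le.
    rewrite divr_ge0//; apply: (@le_trans _ _ `|S 0 - 0 * S 1|) => //.
    by apply: ub_le_sup => //; exists 0 => //=; rewrite in_itv/= lexx ler01.
  move=> k; rewrite mem_index_iota => /andP[k1 kn].
  rewrite ler_pdivlMr// mulrC -SE; apply: ub_le_sup => //.
  exists (k%:R / n%:R) => //=; rewrite in_itv/= divr_ge0//= ler_pdivrMr// mul1r ler_nat.
  by rewrite -ltnS.
rewrite lerBlDr addrC; apply: ge_sup; first exact: bridge_set_neq0.
by move=> _ [t /= t01 <-]; apply: tM; move: t01; rewrite in_itv.
Qed.

End Paths.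

(** * Deterministic comparison of the ratios *)

Section RatioClose.
Context {R : realType}.

(** A pathwise Markov bound. If $|V-c^2|\ge3c^2/4$ the first term is at least 1. Otherwise $\sqrt
    V\ge c/2$, and the discrepancy is at most the bracket, which is therefore at least [del]. *)
Lemma ratio_close (c K del V phi M D : R) : 0 < c -> 0 < del ->
  `|phi / c| <= K -> `|phi - M| <= D -> del <= `|M / Num.sqrt V - phi / c| ->
  1 <= 4 / (3 * c ^+ 2) * `|V - c ^+ 2| + (2 / c * D + 2 * K / c ^+ 2 * `|V - c ^+ 2|) / del.
Proof.
move=> c0 del0 phiK phiM far.
have c20 : 0 < c ^+ 2 by rewrite exprn_gt0.
have D0 : 0 <= D by exact: le_trans phiM.
have K0 : 0 <= K by exact: le_trans phiK.
set v := `|V - c ^+ 2|; have v0 : 0 <= v by exact: normr_ge0.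
have t1 : 0 <= 4 / (3 * c ^+ 2) * v by rewrite mulr_ge0// divr_ge0// mulr_ge0// ltW.
have t2 : 0 <= 2 / c * D + 2 * K / c ^+ 2 * v.
  by rewrite addr_ge0 ?mulr_ge0 ?invr_ge0 ?(ltW c0) ?(ltW c20).
have [big|small] := leP (3 * c ^+ 2 / 4) v.
  rewrite (@le_trans _ _ (4 / (3 * c ^+ 2) * v))//; last by rewrite lerDl divr_ge0// ltW.
  have -> : 4 / (3 * c ^+ 2) = (3 * c ^+ 2 / 4)^-1 by field; rewrite gt_eqF.
  by rewrite mulrC ler_pdivlMr ?mul1r// divr_gt0// mulr_gt0.
rewrite (@le_trans _ _ ((2 / c * D + 2 * K / c ^+ 2 * v) / del))//; last by rewrite lerDr.
rewrite ler_pdivlMr// mul1r (le_trans far)//.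
have Vc : (c / 2) ^+ 2 <= V.
  by move: small; rewrite /v ltr_norml => /andP[h _]; rewrite expr_div_n; lra.
set s := Num.sqrt V.
have V0 : 0 <= V by apply: le_trans Vc; exact: sqr_ge0.
have sV : s ^+ 2 = V by rewrite sqr_sqrtr.
have cs : c / 2 <= s.
  by rewrite -[leLHS]ger0_norm ?divr_ge0 ?(ltW c0)// -sqrtr_sqr ler_wsqrtr.
have s0 : 0 < s by apply: lt_le_trans cs; rewrite divr_gt0.
(* Uses $c-s=(c^2-V)/(c+s)$; the denominator $s(c+s)$ is at least $c^2/2$. *)
have -> : M / s - phi / c = - ((phi - M) / s) + phi / c * ((c ^+ 2 - V) / (s * (c + s))).
  rewrite -sV; field; rewrite !gt_eqF ?addr_gt0//.
rewrite (le_trans (ler_normD _ _))// normrN lerD//.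
  rewrite normrM normfV (gtr0_norm s0) mulrC ler_pM ?invr_ge0 ?(ltW s0)//.
  rewrite -[2 / c]invf_div lef_pV2 ?posrE// divr_gt0//.
rewrite normrM (_ : 2 * K / c ^+ 2 * v = K * (v * (2 / c ^+ 2))); last by field; rewrite gt_eqF.
apply: ler_pM => //; rewrite normrM distrC -/v ler_wpM2l// normfV.
have sc : 0 < s * (c + s) by rewrite mulr_gt0// addr_gt0.
rewrite (gtr0_norm sc) -[2 / _]invf_div lef_pV2 ?posrE// ?divr_gt0//.
by rewrite expr2 mulrAC ler_pM ?(ltW c0) ?divr_ge0 ?(ltW c0)// lerDl ltW.
Qed.

(** The factor $n^{-(H-1/2)}$ equals $n^{-H}\sqrt n$ and absorbs the $\sqrt n$ of the statistic;
    $q^{H-1/2}$ is the square root of $q^{2H-1}$. *)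
Lemma normalisation (H : R) (q n : nat) (s m : R) : (0 < q)%N -> (0 < n)%N ->
  (q%:R / n%:R) `^ (H - 1 / 2) * ((Num.sqrt n%:R * Num.sqrt s)^-1 * m) =
  n%:R `^ (- H) * m / Num.sqrt (s / q%:R `^ (2 * H - 1)).
Proof.
move=> q0 n0.
have q0' : 0 < q%:R :> R by rewrite ltr0n.
have n0' : 0 < n%:R :> R by rewrite ltr0n.
have qe : Num.sqrt (q%:R `^ (2 * H - 1)) = q%:R `^ (H - 1 / 2) :> R.
  by rewrite -powR12_sqrt ?powR_ge0// -powRrM; congr (_ `^ _); field.
rewrite (mulrC s) sqrtrM ?invr_ge0 ?powR_ge0// sqrtrV ?powR_ge0// qe.
rewrite powRM ?invr_ge0 ?ler0n// -(powR_inv1 (ler0n R n)) -powRrM.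
have ne : n%:R `^ (-1 * (H - 1 / 2)) = n%:R `^ (- H) * Num.sqrt n%:R :> R.
  rewrite -powR12_sqrt ?ler0n// -powRD; last by apply/implyP => _; rewrite gt_eqF.
  by congr (_ `^ _); field.
rewrite ne; have sn : Num.sqrt n%:R != 0 :> R by rewrite gt_eqF ?sqrtr_gt0.
have qp : q%:R `^ (H - 1 / 2) != 0 :> R by rewrite gt_eqF ?powR_gt0.
rewrite !invfM invrK; move: (Num.sqrt s)^-1 => u.
by field.
Qed.

End RatioClose.

Lemma natr_inv_cvg0 {R : realType} (u : nat -> nat) :
  (forall M : nat, \forall n \near \oo, (M <= u n)%N) ->
  (u n)%:R^-1 @[n --> \oo] --> (0 : R).
Proof.
move=> uoo; apply/cvgrPdist_lt => e e0; near=> n.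
have u0 : 0 < (u n)%:R :> R by rewrite ltr0n; near: n; exact: uoo.
rewrite sub0r normrN gtr0_norm ?invr_gt0// invf_plt ?posrE//.
apply: (lt_le_trans (truncnS_gt _)); rewrite ler_nat.
near: n; exact: uoo.
Unshelve. all: by end_near.
Qed.

(** * The limit theorem under the hypotheses on the sample *)

Section Assembly.
Context {R : realType} {d d' : measure_display} {T : measurableType d} {T' : measurableType d'}.
Variables (P : probability T R) (Q : probability T' R).
Variables (X : nat -> T -> R) (H : R) (W : R -> T' -> R) (q : nat -> nat).
Hypothesis Xm : forall j, measurable_fun setT (X j).
Hypothesis Xst : fourth_order_stationary P X.
Hypothesis H12 : 1 / 2 < H < 1.
Hypothesis WfBm : is_fBm Q H W.
Variables (cH c0 C : R) (N : nat).
Hypothesis cH0 : 0 < cH.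
Hypothesis Scvg : D_converges P Q (partial_sum_process P X H) (fun t w => cH * W t w).
Hypothesis c00 : 0 < c0.
Hypothesis gamma_reg : gamma P X j%:Z / (c0 * j%:R `^ (2 * H - 2)) @[j --> \oo] --> (1 : R).
Hypothesis kappa_le : forall (n : nat) (h : int), (N <= n)%N ->
  \sum_(0 <= r < (n.*2).+1) \sum_(0 <= s < (n.*2).+1)
     `|kappa P X h (r%:Z - n%:Z) (s%:Z - n%:Z)| <= C * n%:R `^ (2 * H - 1).
Hypothesis q0 : forall n, (0 < q n)%N.
Hypothesis qoo : forall M : nat, \forall n \near \oo, (M <= q n)%N.
Hypothesis qn0 : (q n)%:R / n%:R @[n --> \oo] --> (0 : R).

Let a : R := 2 * H - 1.
Let Y (i : nat) w := X i.+1 w - mean P X.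
Let gam (h : nat) : R := gamma P X h%:Z.
Let kap (i j k l : nat) : R := kappa P X (j%:Z - i%:Z) (k%:Z - i%:Z) (l%:Z - i%:Z).
Let x n (w : T) := partial_sum_process P X H n 1 w.

Let a01 : 0 < a < 1.
Proof. by have /andP[h1 h2] := H12; rewrite /a; apply/andP; split; lra. Qed.
Let a0 : 0 < a. Proof. by case/andP: a01. Qed.
Let a1 : a < 1. Proof. by case/andP: a01. Qed.
Let H0 : 0 < H. Proof. by have /andP[h1 h2] := H12; lra. Qed.

Let YL4 i : L4 P (Y i). Proof. exact: L4Z_centered. Qed.

Let Y2 i j : Ex P (fun w => Y i w * Y j w) = gam `|i - j|%N.
Proof.
have := cov_centered Xm Xst i.+1 j.+1; rewrite /Y /gam => ->.
by congr (gamma _ _ _); lia.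
Qed.

Let Y4 i j k l : Ex P (fun w => Y i w * Y j w * Y k w * Y l w) =
  gam `|i - j|%N * gam `|k - l|%N + gam `|i - k|%N * gam `|j - l|%N
  + gam `|i - l|%N * gam `|j - k|%N + kap i j k l.
Proof.
have := moment4_centered Xm Xst i.+1 j.+1 k.+1 l.+1; rewrite /Y /gam => ->.
have e (u v : nat) : `|u.+1 - v.+1|%N = `|u - v|%N by lia.
have ez (u v : nat) : u.+1%:Z - v.+1%:Z = u%:Z - v%:Z by lia.
by rewrite (e i j) (e k l) (e i k) (e j l) (e i l) (e j k) (ez j i) (ez k i) (ez l i).
Qed.

Lemma D_cvg_Ex (F : (R -> R) -> R) : D_test F ->
  intg Q (fun w => F (fun t => cH * W t w)) ->
  Ex P (fun w => F (partial_sum_process P X H n ^~ w)) @[n --> \oo] -->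
  Ex Q (fun w => F (fun t => cH * W t w)).
Proof.
move=> DF Fi; have := Scvg DF; rewrite ExE// => /fine_cvg.
rewrite (_ : fine \o _ = fun n => Ex P (fun w => F (partial_sum_process P X H n ^~ w)))//.
by apply/funext => n /=; rewrite fine_Ex.
Qed.

Let xE n w : x n w = n%:R `^ (- H) * \sum_(i < n) Y i w.
Proof. exact: partial_sum_process1. Qed.

Let pow2H n : (0 < n)%N -> (n%:R `^ (- H)) ^+ 2 = (n%:R * n%:R `^ a)^-1 :> R.
Proof.
move=> n0; have n0' : 0 < n%:R :> R by rewrite ltr0n.
rewrite powRN exprVn; congr (_^-1).
rewrite -powR_mulrn ?powR_ge0// -powRrM -[n%:R in RHS](powRr1 (ler0n R n)).
rewrite powRr1// -{2}(powRr1 (ler0n R n)) -powRD; last by apply/implyP => _; rewrite gt_eqF.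
by congr (_ `^ _); rewrite /a; ring.
Qed.

Let L4x n : L4 P (x n).
Proof.
rewrite (_ : x n = fun w => n%:R `^ (- H) * \sum_(i < n) Y i w); last first.
  by apply/funext => w; exact: xE.
by apply: L4Z; exact: L4_sum.
Qed.

Let v n : R := sum_var gam n / (n%:R * n%:R `^ a).

Let Ex_x2 n : (0 < n)%N -> Ex P (fun w => x n w ^+ 2) = v n.
Proof.
move=> n0; rewrite (@eq_Ex _ _ _ _ _ (fun w => (n%:R * n%:R `^ a)^-1 * (\sum_(i < n) Y i w) ^+ 2)).
  rewrite ExZ; first by rewrite (Ex_sqr_partial_sum YL4 Y2) mulrC.
  under eq_fun do rewrite sqr_sum_quad.
  exact: (intg_quad YL4).
by move=> w; rewrite xE exprMn pow2H.
Qed.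

(* The bound, unlike [|gam h|] itself, is decreasing in [h]. *)
Lemma covariance_bound : exists2 D : R, 0 <= D & forall h, `|gam h| <= D * h.+1%:R `^ (a - 1).
Proof.
apply: (@regular_bound R a c0 gam a01 c00).
by rewrite (_ : a - 1 = 2 * H - 2)// /a; ring.
Qed.

Lemma kap_sum_le n : (N <= n)%N -> forall i j : 'I_n,
  \sum_(k < n) \sum_(l < n) `|kap i j k l| <= C * n%:R `^ a.
Proof. by move=> Nn i j; exact: (kappa_sum_le kappa_le Nn i j). Qed.

Section WithBound.
Variable D : R.
Hypotheses (D0 : 0 <= D) (gam_le : forall h, `|gam h| <= D * h.+1%:R `^ (a - 1)).

Let g h : R := D * h.+1%:R `^ (a - 1).
Let K : R := D * a^-1.

Let g_dec h h' : (h <= h')%N -> g h' <= g h.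
Proof. by move=> hh; rewrite ler_wpM2l// powR_sub1_dec. Qed.

Let gK n : \sum_(h < n) g h <= K * n%:R `^ a.
Proof. by rewrite -mulr_sumr -mulrA ler_wpM2l// sum_powR_le. Qed.

Lemma sum_var_cvg : v n @[n --> \oo] --> cH ^+ 2.
Proof.
have [mW _] := WfBm.
have := @second_moment_cvg R d d' T T' P Q H W H0 WfBm x cH
  (32 * K ^+ 2 + 2 * `|C| + 4 * K ^+ 2) (maxn N 1) L4x.
move=> h; have {}h : Ex P (fun w => x n w ^+ 2) @[n --> \oo] --> cH ^+ 2.
  apply: h.
    move=> n; rewrite geq_max => /andP[Nn n0].
    have h4 := Ex_partial_sum4_le YL4 Y2 Y4 gam_le g_dec a01 gK kap_sum_le Nn n0.
    have n0' : 0 < n%:R * n%:R `^ a :> R by rewrite mulr_gt0 ?powR_gt0 ?ltr0n.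
    rewrite (@eq_Ex _ _ _ _ _ (fun w => ((n%:R * n%:R `^ a)^-1) ^+ 2 * (\sum_(i < n) Y i w) ^+ 4)).
      rewrite ExZ; last exact: (intg_partial_sum4 YL4).
      by rewrite exprVn mulrC ler_pdivrMr ?exprn_gt0.
    by move=> w; rewrite xE exprMn -pow2H// -exprM.
  move=> f fc fb; apply: (D_cvg_Ex (D_test_end fc fb)).
  have [M fM] := fb; apply: (intg_comp_bounded Q fc fM).
  by apply: measurable_funM => //; exact: measurable_cst.
apply: cvg_trans h; apply: near_eq_cvg.
by exists 1 => // n /= n0; rewrite Ex_x2.
Qed.

Let m n := (q n).+1.
Let rate n : R := (m n)%:R / n%:R * (n%:R `^ a / (m n)%:R `^ a).

Lemma mn_cvg0 : (m n)%:R / n%:R @[n --> \oo] --> (0 : R).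
Proof.
rewrite (_ : (fun n => _) = fun n => (q n)%:R / n%:R + n%:R^-1 :> R); last first.
  by apply/funext => n; rewrite /m -natr1 mulrDl mul1r.
rewrite -[0]addr0; apply: cvgD => //.
by apply: (@natr_inv_cvg0 R id) => M; exists M.
Qed.

(** The rate is $(m/n)^{1-a}$ with a positive exponent, so $m/n<e^{1/(1-a)}$ is the threshold. *)
Lemma rate_cvg0 : rate n @[n --> \oo] --> (0 : R).
Proof.
have p0 : 0 < 1 - a by rewrite subr_gt0.
apply/cvgrPdist_lt => e e0.
have e'0 : 0 < e `^ (1 - a)^-1 by rewrite powR_gt0.
have /cvgrPdist_lt/(_ _ e'0)[N1 _ hN1] := mn_cvg0.
exists (maxn N1 1) => // n /=; rewrite geq_max => /andP[N1n n0].
have := hN1 n N1n; rewrite /= !sub0r !normrN.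
have n0' : 0 < n%:R :> R by rewrite ltr0n.
have m0' : 0 < (m n)%:R :> R by rewrite ltr0n.
set y := (m n)%:R / n%:R; have y0 : 0 < y by rewrite divr_gt0.
have -> : rate n = y `^ (1 - a).
  rewrite powRB; last by apply/implyP => _; rewrite gt_eqF.
  rewrite powRr1 ?(ltW y0)// /rate -/y; congr (_ * _).
  rewrite /y powRM ?invr_ge0 ?(ltW m0') ?(ltW n0')//.
  by rewrite -(powR_inv1 (ltW n0')) -powRrM mulN1r powRN invfM invrK mulrC.
rewrite gtr0_norm// gtr0_norm ?powR_gt0// => ye.
have pe : e = (e `^ (1 - a)^-1) `^ (1 - a).
  by rewrite -powRrM mulVf ?gt_eqF// powRr1// ltW.
rewrite [ltRHS]pe.
by apply: gt0_ltr_powR => //; rewrite nnegrE ltW.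
Qed.

(** The correction for dividing by $q^a$ instead of $m^a$; since $0<a<1$ it lies between 1 and
    $m/q=1+1/q$. *)
Let rho n : R := (m n)%:R `^ a / (q n)%:R `^ a.

Lemma rho_cvg1 : rho n @[n --> \oo] --> (1 : R).
Proof.
apply: (@squeeze_cvgr _ _ _ _ (fun=> 1) (fun n => 1 + (q n)%:R^-1)).
- near=> n.
  have q0' : 0 < (q n)%:R :> R by rewrite ltr0n.
  have m0' : 0 < (m n)%:R :> R by rewrite ltr0n.
  have qa0 : 0 < (q n)%:R `^ a :> R by rewrite powR_gt0.
  apply/andP; split.
    have qm : (q n)%:R <= (m n)%:R :> R by rewrite ler_nat leqnSn.
    rewrite /rho ler_pdivlMr// mul1r; apply: ge0_ler_powR qm; first exact: ltW.
    - by rewrite nnegrE ltW.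
    - by rewrite nnegrE ltW.
  have e : 1 + (q n)%:R^-1 = (m n)%:R / (q n)%:R :> R.
    by rewrite /m -natr1 mulrDl mul1r divff// gt_eqF.
  rewrite e.
  have -> : rho n = ((m n)%:R / (q n)%:R) `^ a.
    rewrite powRM ?invr_ge0 ?(ltW m0') ?(ltW q0')//.
    by rewrite -(powR_inv1 (ltW q0')) -powRrM mulN1r powRN.
  apply: ler1_powR; last exact: ltW.
  by rewrite -e lerDl invr_ge0.
- exact: cvg_cst.
- by rewrite -[X in _ --> X]addr0; apply: cvgD; [exact: cvg_cst|exact: natr_inv_cvg0 qoo].
Unshelve. all: by end_near.
Qed.

(** Written as the quadratic form so that integrability holds for every [n]; it is $s_n^2/q^a$ once
    $n>0$. *)
Definition scaled_s2 n w : R :=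
  quad (fun i w => Y i w - n%:R^-1 * \sum_(i < n) Y i w) n (@bw R (m n)) w
     / (n%:R * (m n)%:R) / (q n)%:R `^ a.

Lemma scaled_s2E n w : (0 < n)%N -> scaled_s2 n w = s2 X q n w / (q n)%:R `^ a.
Proof. by move=> n0; rewrite (s2_quad P)// /scaled_s2. Qed.

Lemma intg_scaled_s2 n : intg P (scaled_s2 n).
Proof.
rewrite /scaled_s2; under eq_fun do rewrite -mulrA mulrC.
by apply: intgZ; apply: intg_quad; exact: L4_centred.
Qed.

(** Comparison with [rho n * v (m n)] leaves [rho n] times the bound of [long_run_variance_L1], and
    a deterministic error that vanishes because $m(n)\to\infty$. The condition $m\le n$ holds
    eventually as $m/n\to0$. *)
Lemma scaled_s2_cvg_L1 : Ex P (fun w => `|scaled_s2 n w - cH ^+ 2|) @[n --> \oo] --> (0 : R).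
Proof.
pose V0 : R := 32 * K ^+ 2 + 2 * `|C|.
pose B n := rho n * (14 * K * rate n + Num.sqrt (V0 * rate n)) + `|rho n * v (m n) - cH ^+ 2|.
apply: (@squeeze_cvgr _ _ _ _ (fun=> 0) B).
- have mn1 : \forall n \near \oo, (m n)%:R / n%:R < (1 : R).
    have /cvgrPdist_lt/(_ 1 ltr01) := mn_cvg0; apply: filterS => n.
    by rewrite sub0r normrN; apply: le_lt_trans; exact: ler_norm.
  near=> n.
  have n0 : (0 < n)%N by near: n; exists 1.
  have Nn : (N <= n)%N by near: n; exists N.
  have n0' : 0 < n%:R :> R by rewrite ltr0n.
  have m0' : 0 < (m n)%:R :> R by rewrite ltr0n.
  have ma0 : 0 < (m n)%:R `^ a :> R by rewrite powR_gt0.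
  have qa0 : 0 < (q n)%:R `^ a :> R by rewrite powR_gt0 ?ltr0n.
  have mn : (m n <= n)%N.
    rewrite -(ler_nat R) -[leRHS]mul1r -ler_pdivrMr// ltW//; near: n; exact: mn1.
  have rho0 : 0 < rho n by rewrite divr_gt0.
  have := long_run_variance_L1 YL4 Y2 Y4 gam_le g_dec a01 gK kap_sum_le Nn (ltn0Sn (q n)) mn.
  rewrite -/(m n) -/(rate n) -/V0 -/(v (m n)) /=.
  set U := fun w => _; move=> hU.
  have iU' : intg P (fun w => quad (fun i w => Y i w - n%:R^-1 * \sum_(i < n) Y i w) n (@bw R (m n)) w
      / (n%:R * (m n)%:R * (m n)%:R `^ a) - v (m n)).
    apply: intgB; last exact: intg_cst.
    under eq_fun do rewrite mulrC.
    by apply: intgZ; apply: intg_quad; exact: L4_centred.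
  have iU : intg P U by exact: intg_norm iU'.
  rewrite Ex_ge0//=.
  apply: (@le_trans _ _ (Ex P (fun w => rho n * U w + `|rho n * v (m n) - cH ^+ 2|))).
    apply: le_Ex.
    - by apply: intg_norm; apply: intgB; [exact: intg_scaled_s2|exact: intg_cst].
    - by apply: intgD; [exact: intgZ|exact: intg_cst].
    move=> w; rewrite /U -{1}(gtr0_norm rho0) -normrM.
    rewrite [X in `|X| <= _](_ : _ = rho n * (quad (fun i w => Y i w - n%:R^-1 * \sum_(i < n) Y i w) n (@bw R (m n)) w
      / (n%:R * (m n)%:R * (m n)%:R `^ a) - v (m n)) + (rho n * v (m n) - cH ^+ 2)).
      exact: ler_normD.
    rewrite /scaled_s2 /rho; field; rewrite !gt_eqF//.
  have ic := intg_cst P `|rho n * v (m n) - cH ^+ 2|; have iz := intgZ (rho n) iU.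
  by rewrite ExD// ExZ// Ex_cst /B lerD2r ler_wpM2l ?(ltW rho0).
- exact: cvg_cst.
- have -> : 0 = 1 * (14 * K * 0 + Num.sqrt (V0 * 0)) + `|1 * cH ^+ 2 - cH ^+ 2| :> R.
    by rewrite !mulr0 sqrtr0 addr0 mulr0 mul1r subrr normr0 addr0.
  apply: cvgD.
    apply: cvgM; first exact: rho_cvg1.
    apply: cvgD; first by apply: cvgMr; exact: rate_cvg0.
    have h0 : V0 * rate n @[n --> \oo] --> V0 * 0 by apply: cvgMr; exact: rate_cvg0.
    exact: (cvg_comp _ _ h0 (@sqrt_continuous R (V0 * 0))).
  apply: cvg_norm; apply: cvgB; last exact: cvg_cst.
  apply: cvgM; first exact: rho_cvg1.
  have moo : m n @[n --> \oo] --> \oo.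
    by apply/cvgnyPge => A; have := qoo A; apply: filterS => n An; exact: leqW.
  exact: (cvg_comp _ _ moo sum_var_cvg).
Unshelve. all: by end_near.
Qed.

(** $E|x_n|$ is at most the square root of the convergent [v n]. This is the cost of exchanging the
    supremum over $t$ for the maximum over $k$. *)
Lemma partial_sum_div_cvg0 : Ex P (fun w => `|x n w| / n%:R) @[n --> \oo] --> (0 : R).
Proof.
apply: (@squeeze_cvgr _ _ _ _ (fun=> 0) (fun n => Num.sqrt (v n) * n%:R^-1)).
- near=> n.
  have n0 : (0 < n)%N by near: n; exists 1.
  have i1 : intg P (x n) by exact: L4_intg.
  have i2 : intg P (fun w => x n w ^+ 2).
    by under eq_fun do rewrite expr2; exact: L4_intg2.
  rewrite Ex_ge0/=; last by move=> w; rewrite divr_ge0.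
  rewrite (@eq_Ex _ _ _ _ _ (fun w => n%:R^-1 * `|x n w|)); last by move=> w; rewrite mulrC.
  rewrite ExZ; last exact: intg_norm.
  by rewrite mulrC ler_wpM2r ?invr_ge0// -Ex_x2// Ex_norm_le_sqrt.
- exact: cvg_cst.
- rewrite -[X in _ --> X](mulr0 (Num.sqrt (cH ^+ 2))); apply: cvgM.
    exact: (cvg_comp _ _ sum_var_cvg (@sqrt_continuous R (cH ^+ 2))).
  by apply: (@natr_inv_cvg0 R id) => M; exists M.
Unshelve. all: by end_near.
Qed.

End WithBound.

Lemma measurable_s2 n : measurable_fun setT (s2 X q n).
Proof.
have mxbar : measurable_fun setT (xbar X n).
  by apply: measurable_funM; [exact: measurable_cst|exact: measurable_sumr].
have mgam j : measurable_fun setT (gamma_hat X n j).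
  apply: measurable_funM; first exact: measurable_cst.
  by apply: measurable_sumr => i; apply: measurable_funM; exact: measurable_funB.
apply: measurable_funD; first exact: mgam.
apply: measurable_funM; first exact: measurable_cst.
by apply: measurable_sumr => j; apply: measurable_funM; [exact: measurable_cst|exact: mgam].
Qed.

Lemma measurable_Tn n : measurable_fun setT (Tn X q n).
Proof.
apply: measurable_funM.
  (* On nonnegative reals the inverse is the power $-1$, also at 0, which gives its
     measurability. *)
  rewrite (_ : (fun w => _) = (fun w => (Num.sqrt n%:R * Num.sqrt (s2 X q n w)) `^ (-1))).
    apply: (measurableT_comp (@measurable_powR R (-1))).
    apply: measurable_funM; first exact: measurable_cst.
    apply: measurableT_comp (measurable_s2 n).
    by apply: continuous_measurable_fun; exact: sqrt_continuous.
  by apply/funext => w; rewrite powR_inv1// mulr_ge0// sqrtr_ge0.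
apply: measurable_bigmaxr => k; apply: measurableT_comp => //.
apply: measurable_funB; first exact: measurable_sumr.
by apply: measurable_funM; [exact: measurable_cst|exact: measurable_sumr].
Qed.

Lemma measurable_bridge_partial_sum n :
  measurable_fun setT (fun w => bridge_sup (partial_sum_process P X H n ^~ w)).
Proof.
apply: measurable_bridge_sup => [t|w|w].
- exact: measurable_partial_sum.
- exact: partial_sum_bounded.
- exact: partial_sum_right_approx.
Qed.

Lemma measurable_bridge_fBm : measurable_fun setT (fun w => bridge_sup (W ^~ w)).
Proof.
have [mW [cW _]] := WfBm; apply: measurable_bridge_sup => // w.
- exact: continuous01_bounded.
- exact: continuous01_right_approx.
Qed.

Lemma normalized_Tn_cvg : conv_dist P Q
  (fun n w => ((q n)%:R / n%:R) `^ (H - 1 / 2) * Tn X q n w)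
  (fun w => bridge_sup (W ^~ w)).
Proof.
have [D D0 gam_le] := covariance_bound.
have [_ [cW _]] := WfBm.
pose A n w := bridge_sup (partial_sum_process P X H n ^~ w) / cH.
apply: (@conv_dist_close _ _ _ _ _ P Q A _ _ 1).
- move=> n; apply: measurable_funM; last exact: measurable_cst.
  exact: measurable_bridge_partial_sum.
- by move=> n; apply: measurable_funM; [exact: measurable_cst|exact: measurable_Tn].
- exact: measurable_bridge_fBm.
- move=> f fc fb.
  have e w : f (bridge_sup (fun t => cH * W t w) / cH) = f (bridge_sup (W ^~ w)).
    rewrite bridge_sup_scale//; last exact: continuous01_bounded.
    by rewrite mulrC mulKf ?gt_eqF.
  have [M fM] := fb.
  have := D_cvg_Ex (D_test_bridge cH fc fb); rewrite (eq_Ex _ e); apply.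
  under eq_fun do rewrite e.
  exact: (intg_comp_bounded Q fc fM measurable_bridge_fBm).
- move=> K del K0 del0.
  have iV n : intg P (fun w => `|scaled_s2 n w - cH ^+ 2|).
    by apply: intg_norm; apply: intgB; [exact: intg_scaled_s2|exact: intg_cst].
  have iX n : intg P (fun w => `|x n w| / n%:R).
    under eq_fun do rewrite mulrC.
    by apply: intgZ; apply: intg_norm; exact: L4_intg.
  (* [k1] and [k2] collect the coefficients of the variance error and of the discretisation error in
     [ratio_close]. *)
  pose k1 := 4 / (3 * cH ^+ 2) + 2 * K / cH ^+ 2 / del.
  pose k2 := 2 / cH / del.
  exists (fun n w => k1 * `|scaled_s2 n w - cH ^+ 2| + k2 * (`|x n w| / n%:R)).
  have k10 : 0 <= k1.
    apply: addr_ge0; first by rewrite divr_ge0// mulr_ge0// exprn_ge0// ltW.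
    by rewrite !divr_ge0 ?mulr_ge0 ?exprn_ge0 ?(ltW cH0) ?(ltW del0) ?(ltW K0).
  have k20 : 0 <= k2 by rewrite !divr_ge0 ?(ltW cH0) ?(ltW del0).
  split.
  + by move=> n; apply: intgD; exact: intgZ.
  + by move=> n w; rewrite addr_ge0 // mulr_ge0 // divr_ge0.
  + rewrite (_ : (fun n => _) = fun n => k1 * Ex P (fun w => `|scaled_s2 n w - cH ^+ 2|)
        + k2 * Ex P (fun w => `|x n w| / n%:R)); last first.
      by apply/funext => n; rewrite ExD; [rewrite !ExZ|exact: intgZ|exact: intgZ].
    rewrite [X in _ --> X](_ : _ = k1 * 0 + k2 * 0); last by rewrite !mulr0 addr0.
    apply: cvgD; apply: cvgMr; first exact: (scaled_s2_cvg_L1 D0 gam_le).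
    exact: (partial_sum_div_cvg0 D0 gam_le).
  + move=> n w n0 AK far.
    have -> : k1 * `|scaled_s2 n w - cH ^+ 2| + k2 * (`|x n w| / n%:R) =
      4 / (3 * cH ^+ 2) * `|scaled_s2 n w - cH ^+ 2|
      + (2 / cH * (`|x n w| / n%:R) + 2 * K / cH ^+ 2 * `|scaled_s2 n w - cH ^+ 2|) / del.
      by rewrite /k1 /k2; ring.
    apply: (ratio_close cH0 del0 AK (bridge_sup_max_bridge P X H w n0)).
    by rewrite scaled_s2E // /a -normalisation.
Qed.

End Assembly.

Unset Implicit Arguments. Set Strict Implicit.

Theorem theorem3p3 (R : realType)
  (d : measure_display) (T : measurableType d) (P : probability T R)
  (d' : measure_display) (T' : measurableType d') (Q : probability T' R)
  (X : nat -> T -> R) (H : R) (W : R -> T' -> R) (q : nat -> nat) :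
  (forall j, measurable_fun setT (X j)) ->
  fourth_order_stationary P X ->
  1 / 2 < H < 1 ->
  is_fBm Q H W ->
  (* (a) *)
  (exists2 cH : R, 0 < cH &
     D_converges P Q (partial_sum_process P X H) (fun t w => cH * W t w)) ->
  (* (b) *)
  (exists2 c0 : R, 0 < c0 &
     gamma P X j%:Z / (c0 * j%:R `^ (2 * H - 2)) @[j --> \oo] --> (1 : R)) ->
  (* (c) *)
  (exists (C : R) (N : nat), forall (n : nat) (h : int), (N <= n)%N ->
     \sum_(0 <= r < (n.*2).+1) \sum_(0 <= s < (n.*2).+1)
        `|kappa P X h (r%:Z - n%:Z) (s%:Z - n%:Z)|
     <= C * n%:R `^ (2 * H - 1)) ->
  (forall n, (0 < q n)%N) ->
  (forall M : nat, \forall n \near \oo, (M <= q n)%N) ->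
  ((q n)%:R / n%:R @[n --> \oo] --> (0 : R)) ->
  conv_dist P Q
    (fun n w => ((q n)%:R / n%:R) `^ (H - 1 / 2) * Tn X q n w)
    (fun w => sup [set `|W t w - t * W 1 w| | t in `[0, 1]]).
Proof.
move=> Xm Xst H12 WfBm [cH cH0 Scvg] [c0 c00 greg] [C [N kle]] q0 qoo qn0.
exact: (normalized_Tn_cvg Xm Xst H12 WfBm cH0 Scvg c00 greg kle q0 qoo qn0).
Qed.
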